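(* In $\mathbf{S}^2\times\mathbf{S}^1$ with the product metric there is a sequence of embedded minimal tori whose Morse index tends to infinity. Moreover, these tori converge to the foliation of $\mathbf{S}^2\times\mathbf{S}^1$ by the parallel spheres $\mathbf{S}^2\times\{t\}$, $t\in\mathbf{S}^1$.
   Context: $\mathbf{S}^2$ carries the round unit metric and $\mathbf{S}^1$ its standard metric. For a closed minimal surface $\Sigma$ with unit normal $\mathbf{n}$ in a Riemannian $3$-manifold $M$, put $Lu=\Delta u+[|A|^2+\mathrm{Ric}_M(\mathbf{n},\mathbf{n})]u$, where $A$ is the second fundamental form; the Morse index of $\Sigma$ is the number, counted with multiplicity, of negative $\mu$ for which $L\phi+\mu\phi=0$ has a nontrivial solution $\phi$. Convergence of a sequence of surfaces to a lamination or foliation is Hausdorff convergence of the surfaces to the union of its leaves. *)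

(* Defs.v *)
From HB Require Import structures.
From mathcomp Require Import all_boot all_order all_algebra.
From mathcomp Require Import all_classical all_reals all_analysis.
Set Implicit Arguments.
Unset Strict Implicit.
Unset Printing Implicit Defensive.
Import Order.TTheory GRing.Theory Num.Theory.
Import numFieldNormedType.Exports.
Local Open Scope classical_set_scope.
Local Open Scope ring_scope.

(* The library norm on row vectors is the sup norm, so the Euclidean structure
   is introduced separately; both define the same topology. *)
Definition dotv (R : realType) n (u v : 'rV[R]_n) : R :=
  \sum_(i < n) u 0 i * v 0 i.

Definition edist (R : realType) n (u v : 'rV[R]_n) : R :=
  Num.sqrt (dotv (u - v) (u - v)).

(* All iterated directional derivatives exist and are continuous. *)
Definition smooth (R : realType) (V W : normedModType R) (f : V -> W) : Prop :=
  forall s : seq V, let g := foldr (fun v h => 'D_v h) f s in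
    continuous g /\ forall x v, derivable g x v.

(** The Riemannian product S^2 x S^1, as a submanifold of R^3 x R^2.  The
    metric induced by the Euclidean one is the product of the unit round
    metric of S^2 and the standard metric of S^1 (of length 2 pi). *)

Definition usphere (R : realType) n : set 'rV[R]_n := [set y | dotv y y = 1].

Definition S2xS1 (R : realType) : set 'rV[R]_(3 + 2) :=
  [set p | usphere (lsubmx p) /\ usphere (rsubmx p)].

Definition parallel_sphere (R : realType) (t : 'rV[R]_2) :
    set 'rV[R]_(3 + 2) :=
  [set p | usphere (lsubmx p) /\ rsubmx p = t].

(* For p in S^2 x S^1, the orthogonal projection of R^5 onto the tangent space
   at p.  The formula makes sense for every p, which extends tangent fields to
   R^5; the values below at points of S^2 x S^1 do not depend on extensions. *)
Definition tproj (R : realType) (p v : 'rV[R]_(3 + 2)) : 'rV[R]_(3 + 2) :=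
  row_mx (lsubmx v - dotv (lsubmx v) (lsubmx p) *: lsubmx p)
         (rsubmx v - dotv (rsubmx v) (rsubmx p) *: rsubmx p).

Definition vfield (R : realType) := 'rV[R]_(3 + 2) -> 'rV[R]_(3 + 2).

(* Levi-Civita connection of the induced metric *)
Definition nabla (R : realType) (X Y : vfield R) : vfield R :=
  fun p => tproj p ('D_(X p) Y p).

Definition lie_bracket (R : realType) (X Y : vfield R) : vfield R :=
  fun p => 'D_(X p) Y p - 'D_(Y p) X p.

Definition curvature (R : realType) (X Y Z : vfield R) : vfield R :=
  fun p => nabla X (nabla Y Z) p - nabla Y (nabla X Z) p
           - nabla (lie_bracket X Y) Z p.

Definition tfield (R : realType) (v : 'rV[R]_(3 + 2)) : vfield R :=
  fun p => tproj p v.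

(* Ric(v, w) is the trace of u |-> R(u, v) w on the tangent space at p, here
   computed as the trace on R^5 of its composition with the projection. *)
Definition ricci (R : realType) (p v w : 'rV[R]_(3 + 2)) : R :=
  \sum_(i < 3 + 2)
    dotv (curvature (tfield (delta_mx 0 i)) (tfield v) (tfield w) p)
         (delta_mx 0 i).

(** Tori are parametrized by the plane modulo its integer lattice. *)

Definition lattice_periodic (R : realType) (T : Type) (f : 'rV[R]_2 -> T) :
    Prop :=
  forall (x : 'rV[R]_2) (m : 'rV[int]_2), f (x + map_mx intr m) = f x.

Definition pd (R : realType) (W : normedModType R) (i : 'I_2)
    (f : 'rV[R]_2 -> W) : 'rV[R]_2 -> W :=
  'D_(delta_mx 0 i) f.

(* F induces a smooth injective immersion, hence (by compactness) a smooth
   embedding, of the torus into S^2 x S^1; the torus is the range of F. *)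
Record embedded_torus (R : realType) (F : 'rV[R]_2 -> 'rV[R]_(3 + 2)) : Prop :=
  EmbeddedTorus {
    torus_smooth : smooth F;
    torus_periodic : lattice_periodic F;
    torus_sub : forall x, S2xS1 (F x);
    torus_inj : forall x y, F x = F y ->
      exists m : 'rV[int]_2, y = x + map_mx intr m;
    torus_immersion : forall x,
      row_free (\matrix_(i < 2) (pd i F x : 'rV[R]_(3 + 2)))
  }.

Record unit_normal (R : realType) (F N : 'rV[R]_2 -> 'rV[R]_(3 + 2)) : Prop :=
  UnitNormal {
    normal_smooth : smooth N;
    normal_periodic : lattice_periodic N;
    normal_tangent : forall x, tproj (F x) (N x) = N x;
    normal_orth : forall x i, dotv (pd i F x) (N x) = 0;
    normal_unit : forall x, dotv (N x) (N x) = 1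
  }.

Definition fund1 (R : realType) (F : 'rV[R]_2 -> 'rV[R]_(3 + 2))
    (x : 'rV[R]_2) : 'M[R]_2 :=
  \matrix_(i, j) dotv (pd i F x) (pd j F x).

Definition fund2 (R : realType) (F N : 'rV[R]_2 -> 'rV[R]_(3 + 2))
    (x : 'rV[R]_2) : 'M[R]_2 :=
  \matrix_(i, j) dotv (tproj (F x) (pd i (pd j F) x)) (N x).

Definition shape_op (R : realType) (F N : 'rV[R]_2 -> 'rV[R]_(3 + 2))
    (x : 'rV[R]_2) : 'M[R]_2 :=
  invmx (fund1 F x) *m fund2 F N x.

Definition minimal (R : realType) (F N : 'rV[R]_2 -> 'rV[R]_(3 + 2)) : Prop :=
  forall x, \tr (shape_op F N x) = 0.

(* |A|^2 = g^{ij} g^{kl} A_{ik} A_{jl} *)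
Definition fund2_norm2 (R : realType) (F N : 'rV[R]_2 -> 'rV[R]_(3 + 2))
    (x : 'rV[R]_2) : R :=
  \tr (shape_op F N x *m shape_op F N x).

(* Laplace-Beltrami operator of the induced metric,
   det(g)^{-1/2} d_i (det(g)^{1/2} g^{ij} d_j u) *)
Definition laplacian (R : realType) (F : 'rV[R]_2 -> 'rV[R]_(3 + 2))
    (u : 'rV[R]_2 -> R) (x : 'rV[R]_2) : R :=
  (Num.sqrt (\det (fund1 F x)))^-1 *
  \sum_(i < 2) pd i (fun y => Num.sqrt (\det (fund1 F y)) *
     \sum_(j < 2) invmx (fund1 F y) i j * pd j u y) x.

Definition stability_op (R : realType) (F N : 'rV[R]_2 -> 'rV[R]_(3 + 2))
    (u : 'rV[R]_2 -> R) (x : 'rV[R]_2) : R :=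
  laplacian F u x + (fund2_norm2 F N x + ricci (F x) (N x) (N x)) * u x.

(* Functions on the torus are lattice-periodic functions on the plane. *)
Definition eigenfunction (R : realType) (F N : 'rV[R]_2 -> 'rV[R]_(3 + 2))
    (mu : R) (phi : 'rV[R]_2 -> R) : Prop :=
  [/\ smooth phi, lattice_periodic phi &
      forall x, stability_op F N phi x + mu * phi x = 0].

Definition lin_indep (R : realType) (T : Type) n (phi : 'I_n -> T -> R) : Prop :=
  forall c : 'I_n -> R,
    (forall x, \sum_(i < n) c i * phi i x = 0) -> forall i, c i = 0.

(* Dimension of the solution space of L phi + mu phi = 0; it is 0 when mu is
   not an eigenvalue. *)
Definition multiplicity (R : realType) (F N : 'rV[R]_2 -> 'rV[R]_(3 + 2))
    (mu : R) : \bar R :=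
  ereal_sup [set (n%:R)%:E | n in [set n : nat |
    exists phi : 'I_n -> 'rV[R]_2 -> R,
      (forall i, eigenfunction F N mu (phi i)) /\ lin_indep phi]].

Definition morse_index (R : realType) (F N : 'rV[R]_2 -> 'rV[R]_(3 + 2)) :
    \bar R :=
  (\esum_(mu in [set mu : R | (mu < 0)%R]) multiplicity F N mu)%E.

(* Hausdorff convergence of subsets, for the Euclidean distance; on the compact
   S^2 x S^1 this distance and the Riemannian one are bi-Lipschitz equivalent,
   so they give the same convergent sequences. *)
Definition hausdorff_cvg (R : realType) n (A : nat -> set 'rV[R]_n)
    (B : set 'rV[R]_n) : Prop :=
  forall e : R, 0 < e -> \forall k \near \oo,
    (forall a, A k a -> exists2 b, B b & edist a b < e) /\
    (forall b, B b -> exists2 a, A k a & edist a b < e).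

(* Main.v *)
(* In each slice S^2 x {t} take the great circle through the poles in the
   direction of angle k t.  These circles sweep out a "helicoidal" torus, which
   is minimal by symmetry and becomes dense as k grows.

   With s the parameter of the great circles, W^2 = 1 + k^2 cos(s)^2 and
   phi = g(s) cos(m t) / W, the equation L phi = nu phi becomes an ODE for g.
   Looking for g = G(sin(s)^2) with G a power series gives a three-term
   recurrence for the coefficients A_n of G, whose solutions generically have
   ratios tending to 1, the exceptional ones having ratios tending to
   k^2 / (1 + k^2) < 1.  The infimum nu of the parameters for which all A_n are
   nonnegative is an exceptional one: otherwise the coefficients would stay
   positive for slightly smaller parameters.  Hence G is analytic on a disk of
   radius > 1 and phi is smooth.  For m <= k one has nu > 0, so the index is at
   least k + 1. *)

Require Import Defs.
From HB Require Import structures.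
From mathcomp Require Import all_boot all_order all_algebra.
From mathcomp Require Import all_classical all_reals all_analysis.
From mathcomp Require Import ring lra.
Set Implicit Arguments.
Unset Strict Implicit.
Unset Printing Implicit Defensive.
Import Order.TTheory GRing.Theory Num.Theory.
Import numFieldNormedType.Exports.
Local Open Scope classical_set_scope.
Local Open Scope ring_scope.

(** * Directional derivatives and smoothness *)

Section DirectionalDerivatives.
Variable R : realType.

Lemma is_derive_lineP (V W : normedModType R) (f : V -> W) x v a :
  is_derive x v f a <-> is_derive (0 : R) (1 : R) (fun t : R => f (t *: v + x)) a.
Proof.
have e : 'D_v f x = 'D_1 (fun t : R => f (t *: v + x)) 0.
  rewrite /derive; set g1 := fun h => h^-1 *: _; set g2 := fun h => h^-1 *: _.
  suff -> : g1 = g2 by [].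
  by apply/funext => h; rewrite /g1 /g2 /= addr0 scale0r add0r [_%:A]mulr1.
split=> -[d <-].
  by rewrite e; apply: DeriveDef => //; exact: (derivable1P _ _ _).1 d.
by rewrite -e; apply: DeriveDef => //; exact: (derivable1P _ _ _).2 d.
Qed.

Lemma is_deriveE (V W : normedModType R) (f : V -> W) x v a :
  is_derive x v f a -> 'D_v f x = a.
Proof. by case. Qed.

(** Restriction to the line [t *: v + x] turns this into the one-variable chain rule. *)
Lemma is_derive_compR (V : normedModType R) (f : V -> R) (h : R -> R) x v a b :
  is_derive x v f a -> is_derive (f x) 1 h b -> is_derive x v (h \o f) (b * a).
Proof.
move=> /is_derive_lineP df dh; apply/is_derive_lineP.
have dh' : is_derive (f (0 *: v + x)) 1 h b by rewrite scale0r add0r.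
exact: (is_derive1_comp dh' df).
Qed.

Lemma is_derive_coord n (x v : 'rV[R]_n) j :
  is_derive x v (fun y : 'rV[R]_n => y 0 j : R) (v 0 j).
Proof.
apply/is_derive_lineP.
have -> : (fun t : R => (t *: v + x) 0 j : R) = v 0 j *: (@id R) + cst (x 0 j).
  by apply/funext => t; rewrite !mxE mulrC.
by apply: is_derive_eq; rewrite addr0 /GRing.scale /= mulr1.
Qed.

Lemma is_derive_row (V : normedModType R) n (f : V -> 'rV[R]_n) x v
    (a : 'rV[R]_n) :
  (forall j, is_derive x v (fun y => f y 0 j : R) (a 0 j)) -> is_derive x v f a.
Proof.
move=> df.
have d : derivable f x v.
  by apply/derivable_mxP => i j; rewrite ord1; case: (df j).
apply: DeriveDef => //; rewrite derive_mx //; apply/rowP => j.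
by rewrite mxE; case: (df j).
Qed.

Lemma continuous_row (V : topologicalType) n (f : V -> 'rV[R]_n) :
  (forall j, continuous (fun y => f y 0 j : R)) -> continuous f.
Proof.
move=> cf x; apply/cvgrPdist_le => /= e e0; near=> y.
rewrite [leLHS]/Num.Def.normr/= mx_normrE (bigmax_le _ (ltW e0))//= => -[i j] _.
rewrite !mxE /= ord1; move: j; near: y; apply: filter_forall => j.
exact: ((cvgrPdist_le _ _).1 (cf j x)).
Unshelve. all: by end_near. Qed.

(** The list of directions is consumed from its end, the innermost derivative first, so that the
    induction hypothesis applies to ['D_v f], again in the class. *)
Lemma smooth_class (V W : normedModType R) (P : set (V -> W)) :
  (forall f, P f -> continuous f /\
     forall v, P ('D_v f) /\ forall x, derivable f x v) ->
  forall f, P f -> smooth f.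
Proof.
move=> hP f Pf s; suff : P (foldr (fun v h => 'D_v h) f s).
  by move=> /hP[cf df]; split=> // x v; apply: (df v).2.
elim/last_ind: s f Pf => [//|s v ih] f Pf.
by rewrite foldr_rcons; apply/ih/((hP _ Pf).2 v).1.
Qed.

End DirectionalDerivatives.

(** * A class of functions on the torus closed under differentiation *)

Section TrigonometricTerms.
Variables (R : realType) (k : nat) (H : nat -> R -> R).
Hypothesis HD : forall j (y : R), 0 <= y <= 1 -> is_derive y 1 (H j) (H j.+1 y).

(* Syntax for the functions on the plane used below, so that partial derivatives
   are computed by structural recursion.  With s = 2 pi x_0 and t = 2 pi x_1,
   CosT n stands for cos(n t), InvW for (1 + k^2 cos(s)^2)^(-1/2), and Ser j for
   H_j(sin(s)^2), where H_j is the j-th derivative of H_0 on [0, 1]. *)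
Inductive term :=
  | Cst of R | CosS | SinS | CosT of nat | SinT of nat | InvW | Ser of nat
  | Add of term & term | Mul of term & term.

Definition tau : R := pi *+ 2.

Definition W2 (y : R) : R := 1 + k%:R ^+ 2 * cos y ^+ 2.

Lemma W2_gt0 y : 0 < W2 y.
Proof. by rewrite /W2 ltr_pwDl // mulr_ge0 // sqr_ge0. Qed.

Definition invW (y : R) : R := (Num.sqrt (W2 y))^-1.

Fixpoint teval (e : term) (x : 'rV[R]_2) : R :=
  match e with
  | Cst c => c
  | CosS => cos (tau * x 0 0)
  | SinS => sin (tau * x 0 0)
  | CosT n => cos (n%:R * (tau * x 0 1))
  | SinT n => sin (n%:R * (tau * x 0 1))
  | InvW => invW (tau * x 0 0)
  | Ser j => H j (sin (tau * x 0 0) ^+ 2)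
  | Add a b => teval a x + teval b x
  | Mul a b => teval a x * teval b x
  end.

Fixpoint ds (e : term) : term :=
  match e with
  | CosS => Mul (Cst (- tau)) SinS
  | SinS => Mul (Cst tau) CosS
  | Cst _ | CosT _ | SinT _ => Cst 0
  | InvW => Mul (Cst (tau * k%:R ^+ 2))
              (Mul (Mul CosS SinS) (Mul InvW (Mul InvW InvW)))
  | Ser j => Mul (Cst (tau *+ 2)) (Mul (Mul CosS SinS) (Ser j.+1))
  | Add a b => Add (ds a) (ds b)
  | Mul a b => Add (Mul (ds a) b) (Mul a (ds b))
  end.

Fixpoint dt (e : term) : term :=
  match e with
  | CosT n => Mul (Cst (- (n%:R * tau))) (SinT n)
  | SinT n => Mul (Cst (n%:R * tau)) (CosT n)
  | Cst _ | CosS | SinS | InvW | Ser _ => Cst 0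
  | Add a b => Add (dt a) (dt b)
  | Mul a b => Add (Mul (dt a) b) (Mul a (dt b))
  end.

Lemma is_derive_invW (y : R) :
  is_derive y 1 invW (k%:R ^+ 2 * (cos y * sin y * invW y ^+ 3)).
Proof.
have w0 := W2_gt0 y.
have dW : is_derive y 1 W2 (- (2 * k%:R ^+ 2 * cos y * sin y)).
  rewrite /W2; apply: is_derive_eq; rewrite /GRing.scale /=; ring.
have dS := is_derive_compR dW (is_derive1_sqrt w0).
have s0 : (Num.sqrt \o W2) y != 0 by rewrite /= sqrtr_eq0 -ltNge.
apply: (is_derive_eq (is_deriveV s0 dS)).
rewrite /invW /GRing.scale /=; rewrite /= in s0.
by field.
Qed.

Lemma is_derive_coordM (c : R) j (x v : 'rV[R]_2) :
  is_derive x v (fun y : 'rV[R]_2 => c * y 0 j) (c * v 0 j).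
Proof. exact: (is_deriveZ c (is_derive_coord x v j)). Qed.

(** Structural induction. In the case of [Ser], the derivatives of [H] are known on [0, 1] only, and
    this interval contains all values of sin^2. *)
Lemma is_derive_teval e (x v : 'rV[R]_2) :
  is_derive x v (teval e) (v 0 0 * teval (ds e) x + v 0 1 * teval (dt e) x).
Proof.
elim: e => [c|||n|n||j|a iha b ihb|a iha b ihb] /=.
- by rewrite !mulr0 addr0; exact: is_derive_cst.
- apply: (is_derive_eq (is_derive_compR (is_derive_coordM tau 0 x v) (is_derive_cos _))).
  by ring.
- apply: (is_derive_eq (is_derive_compR (is_derive_coordM tau 0 x v) (is_derive_sin _))).
  by ring.
- apply: (is_derive_eq (is_derive_compR (is_deriveZ n%:R (is_derive_coordM tau 1 x v))
    (is_derive_cos _))).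
  by rewrite /GRing.scale /=; ring.
- apply: (is_derive_eq (is_derive_compR (is_deriveZ n%:R (is_derive_coordM tau 1 x v))
    (is_derive_sin _))).
  by rewrite /GRing.scale /=; ring.
- apply: (is_derive_eq (is_derive_compR (is_derive_coordM tau 0 x v) (is_derive_invW _))).
  by ring.
- have dS := is_derive_compR (is_derive_coordM tau 0 x v) (is_derive_sin _).
  have y1 : 0 <= (sin \o (fun y : 'rV[R]_2 => tau * y 0 0)) x ^+ 2 <= 1.
    by rewrite sqr_ge0 /= sin2cos2 gerBl sqr_ge0.
  apply: (is_derive_eq (is_derive_compR (is_deriveX 2 dS) (HD j y1))).
  by rewrite /GRing.scale /=; ring.
- apply: (is_derive_eq (is_deriveD iha ihb)); ring.
- apply: (is_derive_eq (is_deriveM iha ihb)); rewrite /GRing.scale /=; ring.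
Qed.

Lemma is_derive1_continuous (f : R -> R) (y : R) b :
  is_derive y 1 f b -> {for y, continuous f}.
Proof. by move=> [d _]; apply/differentiable_continuous/derivable1_diffP. Qed.

Lemma continuous_coordM (c : R) j : continuous (fun y : 'rV[R]_2 => c * y 0 j).
Proof.
move=> x; apply: (@continuous_comp _ _ _ (fun y : 'rV[R]_2 => y 0 j) ( *%R c)).
  exact: coord_continuous.
exact: mulrl_continuous.
Qed.

Lemma continuous_teval e : continuous (teval e).
Proof.
have cc (f : 'rV[R]_2 -> R) (h : R -> R) x : {for x, continuous f} ->
    {for f x, continuous h} -> {for x, continuous (h \o f)}.
  by move=> cf ch; apply: continuous_comp.
have cS x : {for x, continuous (fun y : 'rV[R]_2 => tau * y 0 0)}.
  exact: continuous_coordM.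
have cT n x : {for x, continuous (fun y : 'rV[R]_2 => n%:R * (tau * y 0 1))}.
  apply: (@continuous_comp _ _ _ (fun y : 'rV[R]_2 => tau * y 0 1) ( *%R n%:R)).
    exact: continuous_coordM.
  exact: mulrl_continuous.
have cC (y : R) : {for y, continuous cos} by exact: continuous_cos.
have cN (y : R) : {for y, continuous sin} by exact: continuous_sin.
elim: e => [c|||n|n||j|a iha b ihb|a iha b ihb] x.
- exact: cst_continuous.
- exact (cc _ cos x (cS x) (cC _)).
- exact (cc _ sin x (cS x) (cN _)).
- exact (cc _ cos x (cT n x) (cC _)).
- exact (cc _ sin x (cT n x) (cN _)).
- exact (cc _ invW x (cS x) (is_derive1_continuous (is_derive_invW _))).
- have y1 : 0 <= sin (tau * x 0 0) ^+ 2 <= 1.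
    by rewrite sqr_ge0 /= sin2cos2 gerBl sqr_ge0.
  have c1 := cc _ sin x (cS x) (cN _).
  have c2 := cc _ (fun y => y ^+ 2) x c1 (@exprn_continuous R 2 _).
  exact (cc _ (H j) x c2 (is_derive1_continuous (HD j y1))).
- exact: cvgD (iha x) (ihb x).
- exact: cvgM (iha x) (ihb x).
Qed.

Lemma derive_teval e (v : 'rV[R]_2) :
  'D_v (teval e) = teval (Add (Mul (Cst (v 0 0)) (ds e)) (Mul (Cst (v 0 1)) (dt e))).
Proof. by apply/funext => x; exact: is_deriveE (is_derive_teval _ _ _). Qed.

Lemma smooth_teval e : smooth (teval e).
Proof.
apply: (@smooth_class _ _ _ (range teval)); last by exists e.
move=> _ [a _ <-]; split=> [|v]; first exact: continuous_teval.
split=> [|x]; last by case: (is_derive_teval a x v).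
by rewrite derive_teval; eexists.
Qed.

Definition tevalv n (e : 'I_n -> term) (x : 'rV[R]_2) : 'rV[R]_n :=
  \row_j teval (e j) x.

Lemma is_derive_tevalv n (e : 'I_n -> term) (x v : 'rV[R]_2) :
  is_derive x v (tevalv e) (tevalv (fun j => Add (Mul (Cst (v 0 0)) (ds (e j)))
                                  (Mul (Cst (v 0 1)) (dt (e j)))) x).
Proof.
apply: is_derive_row => j; rewrite mxE.
rewrite (_ : (fun y => tevalv e y 0 j) = teval (e j)) ?funeqE => [|y].
  exact: is_derive_teval.
by rewrite mxE.
Qed.

Lemma smooth_tevalv n (e : 'I_n -> term) : smooth (tevalv e).
Proof.
apply: (@smooth_class _ _ _ (range (@tevalv n))); last by exists e.
move=> _ [a _ <-]; split=> [|v].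
  apply: continuous_row => j.
  rewrite (_ : (fun y => tevalv a y 0 j) = teval (a j)) ?funeqE => [|y].
    exact: continuous_teval.
  by rewrite mxE.
split=> [|x]; last by case: (is_derive_tevalv a x v).
eexists; first by [].
by apply/esym/funext => x; exact: is_deriveE (is_derive_tevalv _ _ _).
Qed.

Definition dpar (i : 'I_2) : term -> term := if i == 0 then ds else dt.

Lemma pd_teval i e : pd i (teval e) = teval (dpar i e).
Proof.
apply/funext => x; rewrite /pd (is_deriveE (is_derive_teval e x _)) !mxE /dpar.
by case: i => -[|[|//]] hi; rewrite /=; ring.
Qed.

Lemma pd_tevalv n i (e : 'I_n -> term) :
  pd i (tevalv e) = tevalv (fun j => dpar i (e j)).
Proof.
apply/funext => x; rewrite /pd; have -> := is_deriveE (is_derive_tevalv e x _).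
apply/rowP => j; rewrite /tevalv mxE mxE /dpar /= !mxE.
by case: i => -[|[|//]] hi; rewrite /=; ring.
Qed.

End TrigonometricTerms.

(** * Ricci curvature of the product *)

Section ProductCurvature.
Variable R : realType.
Implicit Types (p u v w x y z q : 'rV[R]_(3 + 2)) (j : 'I_(3 + 2)).

(* The inner product on the factor, R^3 or R^2, that contains coordinate j. *)
Definition bdot j u v : R :=
  if (j < 3)%N then dotv (lsubmx u) (lsubmx v) else dotv (rsubmx u) (rsubmx v).

Lemma dotvC n (a b : 'rV[R]_n) : dotv a b = dotv b a.
Proof. by apply: eq_bigr => i _; rewrite mulrC. Qed.

Lemma dotvDr n (a b c : 'rV[R]_n) : dotv a (b + c) = dotv a b + dotv a c.
Proof. by rewrite -big_split; apply: eq_bigr => i _; rewrite mxE mulrDr. Qed.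

Lemma dotvZr n t (a b : 'rV[R]_n) : dotv a (t *: b) = t * dotv a b.
Proof. by rewrite mulr_sumr; apply: eq_bigr => i _; rewrite mxE mulrCA. Qed.

Lemma bdotC j u v : bdot j u v = bdot j v u.
Proof. by rewrite /bdot; case: ifP => _; exact: dotvC. Qed.

Lemma bdot_lshift i u v : bdot (lshift 2 i) u v = dotv (lsubmx u) (lsubmx v).
Proof. by rewrite /bdot (_ : (lshift 2 i < 3)%N = true) //; exact: (ltn_ord i). Qed.

Lemma bdot_rshift i u v : bdot (rshift 3 i) u v = dotv (rsubmx u) (rsubmx v).
Proof. by []. Qed.

Lemma tprojE p v j : tproj p v 0 j = v 0 j - bdot j v p * p 0 j.
Proof.
rewrite /tproj; case: (splitP j) => i ij.
  have -> : j = lshift 2 i by apply: val_inj.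
  by rewrite bdot_lshift row_mxEl !mxE.
have -> : j = rshift 3 i by apply: val_inj.
by rewrite bdot_rshift row_mxEr !mxE.
Qed.

Lemma bdot_tproj j z p y :
  bdot j z (tproj p y) = bdot j z y - bdot j y p * bdot j z p.
Proof.
rewrite /bdot /tproj row_mxKl row_mxKr; case: ifP => _;
  by rewrite dotvDr -scaleNr dotvZr mulNr.
Qed.

Lemma bdot_eq (i j : 'I_(3 + 2)) : (i < 3)%N = (j < 3)%N -> bdot i = bdot j.
Proof. by rewrite /bdot => ->. Qed.

(** The coefficients in the formulas below depend on the factor that contains [j], so the linear
    relation is assumed for the coordinates of that factor alone. *)
Lemma bdot_comb j z (a b : 'rV[R]_(3 + 2)) (s t : R) y :
  (forall i : 'I_(3 + 2), (i < 3)%N = (j < 3)%N -> a 0 i = s * b 0 i + t * y 0 i) ->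
  bdot j z a = s * bdot j z b + t * bdot j z y.
Proof.
move=> h; rewrite /bdot; case: ifP => hj.
  rewrite -!dotvZr -dotvDr; congr dotv; apply/rowP => i; rewrite !mxE.
  by apply: h; rewrite hj; exact: (ltn_ord i).
rewrite -!dotvZr -dotvDr; congr dotv; apply/rowP => i; rewrite !mxE.
by apply: h; rewrite hj.
Qed.

Lemma is_derive_dotv m n (L : 'rV[R]_m -> 'rV[R]_n) (s : 'I_n -> 'I_m)
    (a : 'rV[R]_n) (x v : 'rV[R]_m) :
  (forall (y : 'rV[R]_m) i, L y 0 i = y 0 (s i)) ->
  is_derive x v (fun y : 'rV[R]_m => dotv a (L y)) (dotv a (L v)).
Proof.
move=> hL.
have h i : is_derive x v (fun y : 'rV[R]_m => a 0 i * y 0 (s i)) (a 0 i * v 0 (s i)).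
  exact: (is_deriveZ (a 0 i) (is_derive_coord x v (s i))).
have := is_derive_sum h.
rewrite (_ : \sum_(i < n) _ = (fun y : 'rV[R]_m => dotv a (L y))).
  by move=> H; apply: (is_derive_eq H); apply: eq_bigr => i _; rewrite hL.
by apply/funext => y; rewrite fct_sumE; apply: eq_bigr => i _; rewrite hL.
Qed.

Lemma is_derive_bdot j z p u : is_derive p u (bdot j z) (bdot j z u).
Proof.
rewrite /bdot; case: ifP => _.
  by apply: (@is_derive_dotv _ _ (@lsubmx R 1 3 2) (@lshift 3 2)) => y i; rewrite mxE.
by apply: (@is_derive_dotv _ _ (@rsubmx R 1 3 2) (@rshift 3 2)) => y i; rewrite mxE.
Qed.

Lemma derive_tfield z p u : is_derive p u (tfield z)
  (\row_j - (bdot j z u * p 0 j + bdot j z p * u 0 j)).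
Proof.
apply: is_derive_row => j; rewrite mxE.
rewrite (_ : (fun q => tfield z q 0 j) =
    cst (z 0 j) - (bdot j z * (fun q => q 0 j : R))); last first.
  by apply/funext => q; rewrite /tfield tprojE.
have d1 := is_derive_bdot j z p u.
have d2 : is_derive p u (fun q => q 0 j : R) (u 0 j) := is_derive_coord p u j.
by apply: is_derive_eq; rewrite /GRing.scale /=; ring.
Qed.

(** Stated at every [q] because the expression is differentiated once more; hence the factor
    [1 - bdot j q q], which vanishes on the product. *)
Lemma nabla_tfield y z q j : nabla (tfield y) (tfield z) q 0 j =
  - (bdot j z (tproj q y) * (1 - bdot j q q) * q 0 j
     + bdot j z q * (tproj q y 0 j - bdot j q (tproj q y) * q 0 j)).
Proof.
rewrite /nabla tprojE (is_deriveE (derive_tfield z q (tfield y q))) mxE.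
rewrite (bdotC j (\row__ _)).
rewrite (@bdot_comb j q _ q (- bdot j z (tproj q y)) (- bdot j z q) (tproj q y)).
  by rewrite /tfield; ring.
by move=> i e; rewrite mxE (bdot_eq e) /tfield; ring.
Qed.

Lemma is_derive_bdot_sqr j p u :
  is_derive p u (fun q => bdot j q q) (bdot j p u *+ 2).
Proof.
have h (i : 'I_(3 + 2)) : is_derive p u (fun q => q 0 i ^+ 2 : R) ((p 0 i * u 0 i) *+ 2).
  apply: (is_derive_eq (is_deriveX 2 (is_derive_coord p u i))).
  by rewrite /GRing.scale /=; ring.
rewrite /bdot /dotv; case: ifP => _.
  apply: (is_derive_eq _ (sumrMnl _ _ _ _)).
  rewrite (_ : (fun _ => _) = \sum_(i < 3) (fun q => q 0 (lshift 2 i) ^+ 2 : R)).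
    have := is_derive_sum (fun i : 'I_3 => h (lshift 2 i)).
    by move=> H; apply: (is_derive_eq H); apply: eq_bigr => i _; rewrite !mxE.
  by apply/funext => q; rewrite fct_sumE; apply: eq_bigr => i _; rewrite !mxE expr2.
apply: (is_derive_eq _ (sumrMnl _ _ _ _)).
rewrite (_ : (fun _ => _) = \sum_(i < 2) (fun q => q 0 (rshift 3 i) ^+ 2 : R)).
  have := is_derive_sum (fun i : 'I_2 => h (rshift 3 i)).
  by move=> H; apply: (is_derive_eq H); apply: eq_bigr => i _; rewrite !mxE.
by apply/funext => q; rewrite fct_sumE; apply: eq_bigr => i _; rewrite !mxE expr2.
Qed.

Section AtPoint.
Variable p : 'rV[R]_(3 + 2).
Hypothesis pM : S2xS1 p.

Lemma bdot_pp j : bdot j p p = 1.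
Proof. by rewrite /bdot; case: pM => p1 p2; case: ifP. Qed.

Lemma bdot_tproj_p j v : bdot j p (tproj p v) = 0.
Proof. by rewrite bdot_tproj bdot_pp mulr1 bdotC subrr. Qed.

(** The factor [1 - bdot j q q] vanishes at [p], and so does its derivative [- 2 * bdot j p u] along
    a tangent [u]; the terms containing it drop out. *)
Lemma derive_nabla y z u : (forall i, bdot i p u = 0) ->
  is_derive p u (nabla (tfield y) (tfield z))
   (\row_j (bdot j z p * (bdot j y u * p 0 j + bdot j y p * u 0 j)
            - bdot j z u * tproj p y 0 j)).
Proof.
move=> u0; apply: is_derive_row => i; rewrite mxE.
pose b q : R := bdot i z q; pose a q : R := bdot i y q; pose n q : R := bdot i q q.
pose c q : R := q 0 i.
rewrite (_ : (fun q => nabla _ _ q 0 i) =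
   - ((cst (bdot i z y) - a * b) * (cst 1 - n) * c
     + b * (cst (y 0 i) - a * c - a * (cst 1 - n) * c))); last first.
  apply/funext => q; rewrite nabla_tfield !bdot_tproj tprojE (bdotC i q y).
  by rewrite -[RHS]/(- ((bdot i z y - a q * b q) * (1 - n q) * c q
     + b q * (y 0 i - a q * c q - a q * (1 - n q) * c q))) /a /b /n /c; ring.
have da : is_derive p u a (bdot i y u) := is_derive_bdot i y p u.
have db : is_derive p u b (bdot i z u) := is_derive_bdot i z p u.
have dn : is_derive p u n (bdot i p u *+ 2) := is_derive_bdot_sqr i p u.
have dc : is_derive p u c (u 0 i) := is_derive_coord p u i.
apply: is_derive_eq; rewrite tprojE.
rewrite -[(cst 1 - n) p]/(1 - n p).
rewrite -[((cst (bdot i z y) - a * b) * (cst 1 - n)) p]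
  /((bdot i z y - a p * b p) * (1 - n p)).
rewrite -[(cst (bdot i z y) - a * b) p]/(bdot i z y - a p * b p).
rewrite -[(cst (y 0 i) - a * c - a * (cst 1 - n) * c) p]
  /(y 0 i - a p * c p - a p * (1 - n p) * c p).
rewrite -[(a * (cst 1 - n)) p]/(a p * (1 - n p)) /GRing.scale /=.
rewrite [n p]bdot_pp u0 /a /b /c; ring.
Qed.

End AtPoint.
End ProductCurvature.

(** * Curvature tensor and Ricci curvature at a point of the product *)

Section AtPoint.
Variable R : realType.
Implicit Types (u v w x y z q : 'rV[R]_(3 + 2)) (j : 'I_(3 + 2)).
Variable p : 'rV[R]_(3 + 2).
Hypothesis pM : S2xS1 p.

(** Only the value of [X] at [p] enters, so [X] may be a Lie bracket of projected fields. *)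
Lemma nabla_tfield_at (X : vfield R) z j : nabla X (tfield z) p 0 j =
  - bdot j z p * (X p 0 j - bdot j p (X p) * p 0 j).
Proof.
rewrite /nabla tprojE (is_deriveE (derive_tfield z p (X p))) mxE.
rewrite (@bdotC R j (\row__ _)).
rewrite (@bdot_comb R j p _ p (- bdot j z (X p)) (- bdot j z p) (X p)).
  by rewrite (bdot_pp pM); ring.
by move=> i e; rewrite mxE (@bdot_eq R _ _ e); ring.
Qed.

(** This is the tensor of constant curvature 1, factor by factor; on the circle the two terms
    cancel, the tangent space being a line. *)
Lemma curvature_tfield x y z j :
  curvature (tfield x) (tfield y) (tfield z) p 0 j =
  bdot j z (tproj p y) * tproj p x 0 j - bdot j z (tproj p x) * tproj p y 0 j.
Proof.
have nn (x' y' : 'rV[R]_(3 + 2)) :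
    nabla (tfield x') (nabla (tfield y') (tfield z)) p 0 j =
    bdot j z p * bdot j y' p * tproj p x' 0 j
    - bdot j z (tproj p x') * tproj p y' 0 j.
  have u0 i : bdot i p (tproj p x') = 0 by apply: bdot_tproj_p.
  rewrite /nabla tprojE (is_deriveE (derive_nabla pM y' z u0)) mxE.
  rewrite -/(nabla (tfield y') (tfield z)) (@bdotC R j (\row__ _)).
  set q := \row__ _.
  pose t := bdot j z p * bdot j y' (tproj p x') *: p
            + (bdot j z p * bdot j y' p) *: tproj p x'.
  rewrite (@bdot_comb R j p q t 1 (- bdot j z (tproj p x')) (tproj p y')).
    rewrite (@bdot_comb R j p t p (bdot j z p * bdot j y' (tproj p x'))
      (bdot j z p * bdot j y' p) (tproj p x')).
      by rewrite !bdot_tproj_p // (bdot_pp pM); ring.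
    by move=> i e; rewrite !mxE.
  by move=> i e; rewrite !mxE -!(@bdot_eq R _ _ e); ring.
have entry_eq (a b c : 'rV[R]_(3 + 2)) (a' b' c' : R) : a 0 j = a' -> b 0 j = b' ->
    c 0 j = c' -> (a - b - c) 0 j = a' - b' - c' by move=> <- <- <-; rewrite !mxE.
apply: (etrans (entry_eq _ _ _ _ _ _ (nn x y) (nn y x) (nabla_tfield_at _ _ _))).
set W := lie_bracket _ _ p.
(* The terms normal to the factors are symmetric in [x] and [y] and cancel in the bracket, which is
   therefore tangent. *)
have hW i : W 0 i = bdot i x p * tproj p y 0 i - bdot i y p * tproj p x 0 i.
  rewrite /W /lie_bracket (is_deriveE (derive_tfield _ _ _)).
  rewrite (is_deriveE (derive_tfield _ _ _)) !mxE !bdot_tproj (@bdotC R i x y); ring.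
rewrite (@bdot_comb R j p W (tproj p y) (bdot j x p) (- bdot j y p) (tproj p x)).
  by rewrite !bdot_tproj_p // hW; ring.
by move=> i e; rewrite hW (@bdot_eq R _ _ e); ring.
Qed.

Lemma bdot_delta j v : bdot j v (delta_mx 0 j) = v 0 j.
Proof.
case: (splitP j) => i ij.
  have -> : j = lshift 2 i by apply: val_inj.
  rewrite bdot_lshift /dotv (bigD1 i) //= big1 => [|l li].
    by rewrite !mxE !eqxx mulr1 addr0.
  by rewrite !mxE eqxx (inj_eq (@lshift_inj _ _)) (negPf li) mulr0.
have -> : j = rshift 3 i by apply: val_inj.
rewrite bdot_rshift /dotv (bigD1 i) //= big1 => [|l li].
  by rewrite !mxE !eqxx mulr1 addr0.
by rewrite !mxE eqxx (inj_eq (@rshift_inj _ _)) (negPf li) mulr0.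
Qed.

Lemma dotv_delta n (v : 'rV[R]_n) i : dotv v (delta_mx 0 i) = v 0 i.
Proof.
rewrite /dotv (bigD1 i) //= big1 => [|l li].
  by rewrite !mxE !eqxx mulr1 addr0.
by rewrite !mxE eqxx (negPf li) mulr0.
Qed.

(** The trace over a factor in R^n is (n - 1) |v|^2 - |v|^2 for the component v of the vector in
    that factor: |v|^2 for the sphere, 0 for the circle. *)
Lemma ricci_tangent v : tproj p v = v ->
  ricci p v v = dotv (lsubmx v) (lsubmx v).
Proof.
move=> tv.
have vp j : bdot j v p = 0 by rewrite (@bdotC R j) -tv bdot_tproj_p.
have ricciE i : dotv (curvature (tfield (delta_mx 0 i)) (tfield v) (tfield v) p)
    (delta_mx 0 i) = bdot i v v * (1 - p 0 i ^+ 2) - v 0 i ^+ 2.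
  rewrite dotv_delta curvature_tfield tv bdot_tproj tprojE vp mulr0 subr0.
  by rewrite bdot_delta (@bdotC R i (delta_mx 0 i)) bdot_delta !mxE !eqxx /=; ring.
have trace n (a b : 'rV[R]_n) c : dotv a a = 1 ->
    \sum_(i < n) (c * (1 - a 0 i ^+ 2) - b 0 i ^+ 2) = c * (n%:R - 1) - dotv b b.
  move=> a1; rewrite sumrB -mulr_sumr sumrB sumr_const card_ord -a1.
  by congr (_ * (_ - _) - _); apply: eq_bigr => i _; rewrite expr2.
case: pM => p1 p2; rewrite /ricci (eq_bigr _ (fun i _ => ricciE i)) big_split_ord /=.
have := trace _ _ (lsubmx v) (dotv (lsubmx v) (lsubmx v)) p1.
have := trace _ _ (rsubmx v) (dotv (rsubmx v) (rsubmx v)) p2.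
rewrite (eq_bigr (fun i : 'I_3 => bdot (lshift 2 i) v v * (1 - p 0 (lshift 2 i) ^+ 2)
  - v 0 (lshift 2 i) ^+ 2)); last by move=> i _; rewrite bdot_lshift !mxE.
rewrite (eq_bigr (fun i : 'I_2 => bdot (rshift 3 i) v v * (1 - p 0 (rshift 3 i) ^+ 2)
  - v 0 (rshift 3 i) ^+ 2)); last by move=> i _; rewrite bdot_rshift !mxE.
move=> -> ->; ring.
Qed.

End AtPoint.

(** * The recurrence for the power series coefficients *)

Section Recurrence.
Variables (R : realType) (k : R) (E : R).
Hypotheses (k0 : 0 < k) (E0 : 0 < E).

Let K := 1 + k ^+ 2.

(* Coefficient recurrence of
   (K - k^2 y) (1 - y) (2 G' + 4 y G'') - 2 y G' + (E - nu (K - k^2 y)) G = 0: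
   rec_lead n A_{n+1} = rec_diag n A_n - rec_sub n A_{n-1}. *)
Definition rec_diag (nu : R) (n : nat) : R :=
  (K + k ^+ 2) * (n%:R *+ 2) * (n%:R *+ 2 - 1) + n%:R *+ 2 - E + nu * K.

Definition rec_sub (nu : R) (n : nat) : R :=
  k ^+ 2 * ((n%:R *+ 2 - 2) * (n%:R *+ 2 - 3) + nu).

Definition rec_lead (n : nat) : R := K * (n%:R *+ 2 + 2) * (n%:R *+ 2 + 1).

(** Runs the recurrence on the pairs (A_n, A_{n+1}) from A_0 = 1; the initial A_1 is the case n = 0
    with A_{-1} = 0. *)
Fixpoint rec_pair (nu : R) (n : nat) : R * R :=
  if n is m.+1 then
    let: (a, b) := rec_pair nu m in
    (b, (rec_diag nu m.+1 * b - rec_sub nu m.+1 * a) / rec_lead m.+1)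
  else (1, (nu * K - E) / (K *+ 2)).

Definition rec (nu : R) (n : nat) : R := (rec_pair nu n).1.

Let K_gt0 : 0 < K.
Proof. by rewrite /K ltr_pwDl // sqr_ge0. Qed.

Lemma rec_lead_gt0 n : 0 < rec_lead n.
Proof.
have n0 : 0 <= n%:R :> R by [].
by rewrite /rec_lead mulr_gt0 // ?mulr_gt0 //; lra.
Qed.

Lemma rec0 nu : rec nu 0 = 1. Proof. by []. Qed.

Lemma rec_pair2 nu n : (rec_pair nu n).2 = rec nu n.+1.
Proof. by rewrite /rec /=; case: rec_pair. Qed.

Lemma rec1 nu : rec_lead 0 * rec nu 1 = rec_diag nu 0.
Proof.
rewrite -rec_pair2 /= /rec_lead /rec_diag /=.
by field; rewrite gt_eqF.
Qed.

Lemma recSS nu n : rec_lead n.+1 * rec nu n.+2 =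
  rec_diag nu n.+1 * rec nu n.+1 - rec_sub nu n.+1 * rec nu n.
Proof.
rewrite -rec_pair2 /= -[in RHS]rec_pair2 [rec nu n]/rec.
case: rec_pair => a b /=; rewrite mulrC divfK // gt_eqF //; exact: rec_lead_gt0.
Qed.

Lemma continuous_rec n : continuous (fun nu => rec nu n).
Proof.
suff h : continuous (fun nu => (rec_pair nu n).1) /\
         continuous (fun nu => (rec_pair nu n).2) by apply: h.1.
elim: n => [|n [ih1 ih2]] /=; split.
- by move=> x; exact: cvg_cst.
- move=> x; apply: cvgMr_tmp; apply: cvgB; last exact: cvg_cst.
  by apply: cvgMr_tmp; exact: cvg_id.
- rewrite (_ : (fun _ => _) = (fun nu => (rec_pair nu n).2)) // funeqE => nu.
  by case: rec_pair.
- rewrite (_ : (fun _ => _) = (fun nu => (rec_diag nu n.+1 * (rec_pair nu n).2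
    - rec_sub nu n.+1 * (rec_pair nu n).1) / rec_lead n.+1)); last first.
    by rewrite funeqE => nu; case: rec_pair.
  move=> x; apply: cvgMr_tmp; apply: cvgB; apply: cvgM; try exact: ih1; try exact: ih2.
    apply: cvgD; first exact: cvg_cst.
    by apply: cvgMr_tmp; exact: cvg_id.
  apply: cvgMl_tmp; apply: cvgD; first exact: cvg_cst.
  exact: cvg_id.
Qed.

Definition rho : R := (k ^+ 2 + K) / (K *+ 2).

(* Equal to (1 - rho) (K - k^2 / rho), hence positive: rho is the midpoint of the
   two limiting ratios k^2 / K and 1. *)
Let delta := K + k ^+ 2 - k ^+ 2 / rho - rho * K.

Lemma rho_gt0 : 0 < rho.
Proof. by rewrite divr_gt0 // ?pmulrn_lgt0 // addr_gt0 // exprn_gt0. Qed.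

Lemma rho_lt1 : rho < 1.
Proof. by rewrite ltr_pdivrMr ?pmulrn_lgt0 // mul1r /K mulr2n; lra. Qed.

Let k2K : k ^+ 2 / rho < K.
Proof.
rewrite ltr_pdivrMr ?rho_gt0 // /rho mulrA ltr_pdivlMr ?pmulrn_lgt0 //.
have k2 : 0 < k ^+ 2 by rewrite exprn_gt0.
by rewrite /K; nra.
Qed.

Let delta_gt0 : 0 < delta.
Proof.
have -> : delta = (1 - rho) * (K - k ^+ 2 / rho).
  by rewrite /delta; field; rewrite gt_eqF // rho_gt0.
by rewrite mulr_gt0 // subr_gt0 // rho_lt1.
Qed.

(* If margin nu n >= 0, a ratio A_n / A_{n-1} >= rho forces A_{n+1} / A_n >= rho. *)
Definition margin (nu : R) (n : nat) : R :=
  rec_diag nu n - rec_sub nu n / rho - rho * rec_lead n.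

(** Only the last term contains [nu], with a positive factor, and the rest is quadratic in [n] with
    positive leading coefficient; so one threshold on [n] serves all [nu >= 0]. *)
Lemma marginE nu n : margin nu n = delta * n%:R ^+ 2 *+ 4
  + (- (K + k ^+ 2) *+ 2 + 2 + k ^+ 2 / rho * 10%:R - rho * K * 6%:R) * n%:R
  + (- E - k ^+ 2 / rho * 6%:R - rho * K *+ 2) + nu * (K - k ^+ 2 / rho).
Proof.
rewrite /margin /rec_diag /rec_sub /rec_lead /delta; field.
by rewrite gt_eqF // rho_gt0.
Qed.

(** Once n >= 1 and a n >= |b| + |c|, also a n^2 >= |b| n + |c|. *)
Lemma quadratic_ge0_eventually (a b c : R) : 0 < a ->
  exists n0 : nat, forall n, (n0 <= n)%N -> 0 <= a * n%:R ^+ 2 + b * n%:R + c.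
Proof.
move=> a0; exists (Num.bound ((`|b| + `|c|) / a)).+1 => n hn.
have n1 : 1 <= n%:R :> R by rewrite ler1n (leq_trans _ hn).
have h : `|b| + `|c| <= a * n%:R.
  rewrite -ler_pdivrMl // mulrC; apply: (le_trans (ler_norm _)).
  apply/ltW/(lt_le_trans (archi_boundP (normr_ge0 _))).
  by rewrite ler_nat; apply: leq_trans hn; rewrite ger0_norm // divr_ge0 // ?addr_ge0 // ltW.
have hb := ler_norm (- b); have hc := ler_norm (- c); rewrite !normrN in hb hc.
have c0 := normr_ge0 c; have b0 := normr_ge0 b.
by nra.
Qed.

Lemma margin_ge0_eventually : exists n0, forall nu n, 0 <= nu -> (n0 <= n)%N ->
  0 <= margin nu n.
Proof.
have delta4 : 0 < delta *+ 4 by rewrite pmulrn_lgt0.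
have [n0 h] := quadratic_ge0_eventually
  (- (K + k ^+ 2) *+ 2 + 2 + k ^+ 2 / rho * 10%:R - rho * K * 6%:R)
  (- E - k ^+ 2 / rho * 6%:R - rho * K *+ 2) delta4.
exists n0 => nu n nu0 /h hn; rewrite marginE addr_ge0 //.
  by move: hn; rewrite mulrnAl.
by rewrite mulr_ge0 // subr_ge0 ltW.
Qed.

Lemma rec_sub_ge0 nu n : 0 <= nu -> 0 <= rec_sub nu n.+1.
Proof.
move=> nu0; rewrite /rec_sub mulr_ge0 ?sqr_ge0 // addr_ge0 //.
(* The product is 2n (2n - 1), nonnegative at every natural number but not on the whole half-line;
   hence the case split. *)
rewrite -natr1; case: n => [|n]; first by lra.
have : 0 <= n%:R :> R by []. rewrite -natr1; nra.
Qed.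

Lemma rec_sub_gt0 nu n : 0 < nu -> 0 < rec_sub nu n.+1.
Proof.
move=> nu0; rewrite /rec_sub mulr_gt0 ?exprn_gt0 // ltr_wpDl //.
rewrite -natr1; case: n => [|n]; first by lra.
have : 0 <= n%:R :> R by []. rewrite -natr1; nra.
Qed.

(** Bounding A_n by A_{n+1} / rho in the recurrence leaves [rec_lead] A_{n+2} >= ([rec_diag] -
    [rec_sub] / rho) A_{n+1}, and the margin compares this with rho [rec_lead] A_{n+1}. *)
Lemma margin_step nu n : 0 <= nu -> 0 <= margin nu n.+1 ->
  rho * rec nu n <= rec nu n.+1 -> 0 <= rec nu n.+1 -> rho * rec nu n.+1 <= rec nu n.+2.
Proof.
move=> nu0 m0 ab b0.
rewrite -(ler_pM2l (rec_lead_gt0 n.+1)) recSS.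
have s0 := rec_sub_ge0 n nu0.
have : rec_sub nu n.+1 * rec nu n <= rec_sub nu n.+1 / rho * rec nu n.+1.
  rewrite -mulrA ler_wpM2l // ler_pdivlMl ?rho_gt0 //.
have : 0 <= margin nu n.+1 * rec nu n.+1 by rewrite mulr_ge0.
rewrite /margin; lra.
Qed.

Definition persists nu n := forall m, (n <= m)%N ->
  0 < rec nu m /\ rho * rec nu m <= rec nu m.+1.

Lemma margin_persists nu n : 0 <= nu -> (forall m, (n < m)%N -> 0 <= margin nu m) ->
  0 < rec nu n -> rho * rec nu n <= rec nu n.+1 -> persists nu n.
Proof.
move=> nu0 m0 a0 ab m /subnK <-; elim: (m - n)%N => [//|i [ih1 ih2]].
have h : 0 < rec nu (i + n).+1 by rewrite (lt_le_trans _ ih2) // mulr_gt0 // rho_gt0.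
by split=> //; apply: margin_step (ltW h) => //; apply: m0; rewrite ltnS leq_addl.
Qed.

Definition admissible : set R := [set nu | 0 <= nu /\ forall n, 0 <= rec nu n].

(** The sign of A_1 = (nu K - E) / (2 K) already forces this; it makes the infimum positive. *)
Lemma admissible_ge nu : admissible nu -> E / K <= nu.
Proof.
move=> [_ /(_ 1%N) h]; have := rec1 nu.
have : 0 <= rec_lead 0 * rec nu 1 by rewrite mulr_ge0 // ltW // rec_lead_gt0.
by rewrite /rec_diag ler_pdivrMr // => + e; rewrite e; lra.
Qed.

Lemma admissible_nonempty : admissible !=set0.
Proof.
have [n0 h] := margin_ge0_eventually.
pose d := K - k ^+ 2 / rho.
have d0 : 0 < d by rewrite subr_gt0.
pose B := \sum_(n < n0) `|margin 0 n|.
(* The first summand makes the margins below [n0] nonnegative, as [margin nu n] = [margin 0 n] +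
   [nu * d]; the second gives A_1 >= rho A_0. *)
pose nu := B / d + (E + rho * K *+ 2) / K.
have B0 : 0 <= B by rewrite sumr_ge0.
have nu1 : 0 <= (E + rho * K *+ 2) / K.
  rewrite divr_ge0 ?(ltW K_gt0) // addr_ge0 ?(ltW E0) // mulrn_wge0 //.
  by rewrite mulr_ge0 ?ltW // rho_gt0.
have nu2 : 0 <= B / d by rewrite divr_ge0 // ltW.
have nu0 : 0 <= nu by rewrite addr_ge0.
have m0 n : 0 <= margin nu n.
  have [/h|] := leqP n0 n; first exact.
  move=> nn0; have -> : margin nu n = margin 0 n + nu * d.
    by rewrite !marginE /d; ring.
  have : `|margin 0 n| <= B.
    rewrite /B (bigD1 (Ordinal nn0)) //= lerDl sumr_ge0 //.
  have := ler_norm (- margin 0 n); rewrite normrN.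
  have : B <= nu * d by rewrite -ler_pdivrMr // /nu lerDl.
  lra.
have p : persists nu 0.
  apply: margin_persists => //; rewrite ?rec0 ?mulr1 //.
  rewrite -(ler_pM2l (rec_lead_gt0 0)) rec1 /rec_diag /rec_lead.
  have : E + rho * K *+ 2 <= nu * K by rewrite -ler_pdivrMr // /nu lerDr.
  by rewrite mulr0n; lra.
exists nu; split=> // n; apply: ltW; apply: (p n _).1; exact: leq0n.
Qed.

(* The infimum of the admissible parameters is admissible, and a sequence
   which does not decay would remain positive for slightly smaller ones. *)
Lemma rec_decay : exists2 nu, 0 < nu & rec nu 0 = 1 /\
  exists C r, [/\ 0 < r, r < 1 & forall n, `|rec nu n| <= C * r ^+ n].
Proof.
have lbA : has_lbound admissible by exists (E / K) => nu /admissible_ge.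
have infA : has_inf admissible by split; first exact: admissible_nonempty.
pose nu := inf admissible.
have nuE : E / K <= nu.
  by apply: lb_le_inf; [exact: admissible_nonempty|move=> x /admissible_ge].
have nu_gt0 : 0 < nu by rewrite (lt_le_trans _ nuE) // divr_gt0.
(* By continuity of A_n in the parameter, a negative value at the infimum would persist at nearby
   admissible parameters. *)
have rec_ge0 n : 0 <= rec nu n.
  rewrite leNgt; apply/negP => neg.
  have : \forall x \near nu, rec x n < 0 by exact: (continuous_rec (lt_nbhsl neg)).
  move=> /nbhs_ballP[e /= e0 he].
  have [x Ax] := inf_adherent e0 infA.
  rewrite -/nu => xe; have nx : nu <= x by exact: ge_inf.
  have : rec x n < 0.
    by apply: he; rewrite -ball_normE /= distrC ger0_norm ?subr_ge0 // ltrBlDl.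
  by move=> xn; have := Ax.2 n; rewrite leNgt xn.
(* If A_{n+1} vanished, the recurrence would give A_{n+2} the sign of - A_n, which is negative. *)
have rec_gt0 n : 0 < rec nu n.
  elim: n => [|n ih]; first by rewrite rec0.
  rewrite lt_neqAle rec_ge0 andbT; apply/negP => /eqP e.
  have := recSS nu n; rewrite -e mulr0 sub0r => h.
  have : 0 <= rec_lead n.+1 * rec nu n.+2 by rewrite mulr_ge0 // ltW // rec_lead_gt0.
  by rewrite h oppr_ge0 leNgt mulr_gt0 // rec_sub_gt0.
have [n0 hm] := margin_ge0_eventually.
(* A ratio above rho at some n >= n0 survives small changes of the parameter, as does positivity of
   A_0, ..., A_n. By [margin_persists] all nearby parameters, even one below the infimum, would be
   admissible. *)
have dec n : (n0 <= n)%N -> rec nu n.+1 <= rho * rec nu n.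
  move=> n0n; rewrite leNgt; apply/negP => neg.
  have c1 : \forall x \near nu, rho * rec x n < rec x n.+1.
    have c : (fun x => rec x n.+1 - rho * rec x n) x @[x --> nu] -->
        rec nu n.+1 - rho * rec nu n.
      apply: (@continuousB _ _ _ (fun x => rec x n.+1)); first exact: continuous_rec.
      apply: (@continuousM _ _ (fun=> rho)); first exact: cst_continuous.
      exact: continuous_rec.
    have c0 : 0 < rec nu n.+1 - rho * rec nu n by rewrite subr_gt0.
    have h : \forall x \near nu, 0 < rec x n.+1 - rho * rec x n := c _ (lt_nbhsr c0).
    by apply: filterS h => x; rewrite subr_gt0.
  have c2 : \forall x \near nu, forall i : 'I_n.+1, 0 < rec x i.
    near=> x => i; move: i; near: x; apply: filter_forall => i.
    exact: (continuous_rec (lt_nbhsr (rec_gt0 i))).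
  have c3 : \forall x \near nu, 0 < x by exact: lt_nbhsr.
  have /nbhs_ballP[e /= e0 he] : \forall x \near nu, admissible x.
    near=> x.
    have x0 : 0 < x by near: x.
    have x1 : rho * rec x n < rec x n.+1 by near: x.
    have x2 : forall i : 'I_n.+1, 0 < rec x i by near: x.
    split=> [|m]; first exact: ltW.
    have [mn|nm] := leqP m n; first exact: ltW (x2 (Ordinal (mn : (m < n.+1)%N))).
    apply/ltW/(margin_persists (ltW x0) _ _ (ltW x1) (ltnW nm)).1; last exact: (x2 ord_max).
    by move=> i ni; apply: hm (ltW x0) (leq_trans n0n (ltnW ni)).
  have : admissible (nu - e / 2).
    apply: he; rewrite -ball_normE /= opprB addrC subrK ger0_norm; lra.
  by move=> /(ge_inf lbA); rewrite -/nu; lra.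
exists nu => //; split=> //.
(* C bounds A_n / rho^n for n <= n0; beyond [n0] this quotient does not increase, by [dec]. *)
pose C := \sum_(i < n0.+1) rec nu i / rho ^+ i.
exists C, rho; split; [exact: rho_gt0|exact: rho_lt1|move=> n].
rewrite gtr0_norm // -ler_pdivrMr ?exprn_gt0 ?rho_gt0 //.
have small i : (i <= n0)%N -> rec nu i / rho ^+ i <= C.
  move=> i0; rewrite /C (bigD1 (Ordinal (i0 : (i < n0.+1)%N))) //= lerDl sumr_ge0 // => j _.
  by rewrite divr_ge0 // exprn_ge0 // ltW // rho_gt0.
have [/small//|nn0] := leqP n n0.
rewrite -(subnK (ltnW nn0)); elim: (n - n0)%N => [|i ih]; first exact: small.
have r0 := rho_gt0; have rn := exprn_gt0 (i + n0) r0.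
apply: le_trans ih; rewrite addSn exprS ler_pdivrMr; last exact: mulr_gt0.
by rewrite mulrCA divfK ?gt_eqF //; apply: dec; exact: leq_addl.
Unshelve. all: by end_near. Qed.

End Recurrence.

(** * Power series solutions *)

Section PowerSeries.
Variable R : realType.

Definition geometric_decay (a : nat -> R) := exists C r : R,
  [/\ 0 < r, r < 1 & forall n, `|a n| <= C * r ^+ n].

(** For r < s < 1 the series at 1/s is dominated by a geometric one of ratio r/s. Convergence beyond
    1 gives two-sided derivatives even at the endpoint 1. *)
Lemma geometric_decay_cvg a : geometric_decay a ->
  exists2 z : R, 1 < z & cvgn (pseries a z).
Proof.
move=> [C [r [r0 r1 h]]].
have [s [s0 rs s1]] : exists s, [/\ 0 < s, r < s & s < 1].
  by exists ((1 + r) / 2); split; lra.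
exists s^-1; first by rewrite invf_gt1.
apply: normed_cvg.
apply: (@series_le_cvg _ _ (fun n => C * (r / s) ^+ n)) => [n|n|n|].
- exact: normr_ge0.
- rewrite mulr_ge0 //; last by rewrite exprn_ge0 // divr_ge0 // ltW.
  by have := le_trans (normr_ge0 _) (h 0%N); rewrite expr0 mulr1.
- by rewrite /= normrM exprVn normfV (gtr0_norm (exprn_gt0 n s0)) expr_div_n [leRHS]mulrA
    ler_pM2r // invr_gt0 exprn_gt0.
- apply: is_cvg_geometric_series.
  by rewrite ger0_norm ?divr_ge0 ?(ltW r0) ?(ltW s0) // ltr_pdivrMr // mul1r.
Qed.

(* (n + 1) r^n stays bounded by a multiple of s^n for r < s < 1. *)
Lemma geometric_decay_diffs a : geometric_decay a -> geometric_decay (pseries_diffs a).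
Proof.
move=> [C [r [r0 r1 h]]].
have [s [s0 rs s1]] : exists s, [/\ 0 < s, r < s & s < 1].
  by exists ((1 + r) / 2); split; lra.
have C0 : 0 <= C by have := le_trans (normr_ge0 _) (h 0%N); rewrite expr0 mulr1.
pose q := s / r.
have q1 : 1 < q by rewrite ltr_pdivlMr // mul1r.
have qr : q * r = s by rewrite divfK // gt_eqF.
exists (C * s / (q - 1)), s; split=> // n.
rewrite /pseries_diffs normrM ger0_norm // -qr exprMn.
(* Bernoulli's inequality for q = s / r absorbs the factor n + 1 into a power of q. *)
have bern : n.+1%:R * (q - 1) <= q ^+ n.+1.
  apply: le_trans (_ : 1 + n.+1%:R * (q - 1) <= _); first by rewrite lerDr.
  elim: n.+1 => [|m ih]; first by rewrite mul0r addr0 expr0.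
  rewrite exprS -natr1; apply: le_trans (_ : q * (1 + m%:R * (q - 1)) <= _).
    have := mulr_ge0 (ler0n R m) (sqr_ge0 (q - 1)); lra.
  by rewrite ler_pM2l //; lra.
apply: le_trans (_ : n.+1%:R * (C * r ^+ n.+1) <= _); first by rewrite ler_wpM2l.
have cr : 0 <= C * r ^+ n.+1 by rewrite mulr_ge0 // exprn_ge0 // ltW.
have q0 : 0 < q - 1 by rewrite subr_gt0.
have := ler_wpM2r cr bern; rewrite mulrAC -ler_pdivlMr // => /le_trans; apply.
by rewrite !exprS le_eqVlt; apply/orP; left; apply/eqP; ring.
Qed.

Definition pser (a : nat -> R) (j : nat) (y : R) : R :=
  limn (pseries (iter j (@pseries_diffs R) a) y).

Lemma geometric_decay_iter a j : geometric_decay a ->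
  geometric_decay (iter j (@pseries_diffs R) a).
Proof. by move=> ha; elim: j => [//|j]; exact: geometric_decay_diffs. Qed.

Lemma is_derive_pser a j (y : R) : geometric_decay a -> 0 <= y <= 1 ->
  is_derive y 1 (pser a j) (pser a j.+1 y).
Proof.
move=> ha /andP[y0 y1].
have [z0 z01 c0] := geometric_decay_cvg (geometric_decay_iter j ha).
have [z1 z11 c1] := geometric_decay_cvg (geometric_decay_iter j.+1 ha).
have [z2 z21 c2] := geometric_decay_cvg (geometric_decay_iter j.+2 ha).
(* Termwise differentiation uses convergence of the series and its first two formal derivatives at a
   common point [w] beyond [y]; [w] is taken between 1 and the least of the three points. *)
pose m := Num.min z0 (Num.min z1 z2).
have m1 : 1 < m by rewrite !lt_min z01 z11.
pose w := (1 + m) / 2.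
have w1 : 1 < w by rewrite /w; lra.
have wm : w < m by rewrite /w; lra.
have w0 : `|w| = w by rewrite gtr0_norm; lra.
have wz z : m <= z -> `|w| < `|z|.
  by move=> mz; rewrite w0 gtr0_norm; lra.
apply: (@pseries_snd_diffs _ _ w).
- by apply: is_cvg_pseries_inside c0 (wz _ _); rewrite ge_min lexx.
- by apply: is_cvg_pseries_inside c1 (wz _ _); rewrite !ge_min lexx orbT.
- by apply: is_cvg_pseries_inside c2 (wz _ _); rewrite !ge_min lexx !orbT.
- by rewrite w0 ger0_norm // (le_lt_trans y1).
Qed.

Lemma cvg_pser a j (y : R) : geometric_decay a -> 0 <= y <= 1 ->
  pseries (iter j (@pseries_diffs R) a) y @ \oo --> pser a j y.
Proof.
move=> ha /andP[y0 y1].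
have [z z1 c] := geometric_decay_cvg (geometric_decay_iter j ha).
apply: (is_cvg_pseries_inside c); rewrite ger0_norm // (le_lt_trans y1) //.
by rewrite gtr0_norm //; lra.
Qed.

Lemma pser0 a : pser a 0 0 = a 0%N.
Proof.
apply: cvg_lim => //; rewrite -(cvg_shiftS (pseries _ _)) /=.
rewrite (_ : (fun n => _) = cst (a 0%N)); first exact: cvg_cst.
apply/funext => n; rewrite /pseries /series /= big_nat_recl // expr0 mulr1 big1 ?addr0 // => i _.
by rewrite expr0n mulr0.
Qed.

Definition shift_coef (a : nat -> R) (n : nat) : R := if n is m.+1 then a m else 0.

Lemma pseries_shift a y l : pseries a y @ \oo --> l ->
  pseries (shift_coef a) y @ \oo --> y * l.
Proof.
move=> al; rewrite -(cvg_shiftS (pseries _ _)) /=.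
rewrite (_ : (fun n => _) = (fun n => y * pseries a y n)); first exact: cvgMl_tmp.
apply/funext => n; rewrite /pseries /series /= big_nat_recl //= mul0r add0r mulr_sumr.
by apply: eq_bigr => i _; rewrite exprS mulrCA.
Qed.

Lemma pseries_comb (a b : nat -> R) s t y l m : pseries a y @ \oo --> l ->
  pseries b y @ \oo --> m ->
  pseries (fun n => s * a n + t * b n) y @ \oo --> s * l + t * m.
Proof.
move=> al bm.
rewrite (_ : pseries _ y = (fun n => s * pseries a y n + t * pseries b y n)).
  by apply: cvgD; apply: cvgMl_tmp.
apply/funext => n; rewrite /pseries /series /= !mulr_sumr -big_split /=.
by apply: eq_bigr => i _; ring.
Qed.

End PowerSeries.

(** * The differential equation satisfied by the power series *)

Section SolutionOfODE.
Variables (R : realType) (k E nu : R).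
Let K := 1 + k ^+ 2.
Let A := rec k E nu.
Hypothesis A_decay : geometric_decay A.

(** The left side is the sum of a power series assembled from those of G, G', G'' by shifts and
    linear combinations; its coefficients are differences of the two sides of the recurrence. *)
Lemma pser_rec_ode y : 0 <= y <= 1 ->
  (K - k ^+ 2 * y) * (1 - y) * (pser A 1 y *+ 2 + 4 * y * pser A 2 y)
  - (y *+ 2) * pser A 1 y + (E - nu * (K - k ^+ 2 * y)) * pser A 0 y = 0.
Proof.
move=> y01.
have c0 := @cvg_pser _ _ 0 _ A_decay y01.
have c1 := @cvg_pser _ _ 1 _ A_decay y01.
have c2 := @cvg_pser _ _ 2 _ A_decay y01.
pose comb s t := fun a b => @pseries_comb R a b s t y.
have b0 := comb 2 4 _ _ _ _ c1 (pseries_shift c2).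
have b1 := pseries_shift b0.
have b2 := pseries_shift b1.
have e1 := comb K (- (K + k ^+ 2)) _ _ _ _ b0 b1.
have e2 := comb (k ^+ 2) (- 2) _ _ _ _ b2 (pseries_shift c1).
have e3 := comb (E - nu * K) (nu * k ^+ 2) _ _ _ _ c0 (pseries_shift c0).
have e := comb 1 1 _ _ _ _ e1 (comb 1 1 _ _ _ _ e2 e3).
have z : pseries (fun=> 0 : R) y @ \oo --> (0 : R).
  rewrite (_ : pseries _ y = cst 0); first exact: cvg_cst.
  apply/funext => n; rewrite /pseries /series /= big1 // => i _; by rewrite mul0r.
move: e; set c := (X in pseries X y).
have -> : c = fun=> 0.
  have eq0 (a b d : R) : a = b -> d = a - b -> d = 0 by move=> -> ->; rewrite subrr.
  apply/funext => -[|[|m]]; rewrite /c /=.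
  - apply: (eq0 _ _ _ (rec1 k E nu)).
    by rewrite /A /rec_lead /rec_diag /pseries_diffs rec0 -/K; ring.
  - apply: (eq0 _ _ _ (recSS k E nu 0)).
    by rewrite /A /rec_lead /rec_diag /rec_sub /pseries_diffs -/K; ring.
  (* The coefficient of y^m in y G''; thanks to the factor m the formula includes m = 0. *)
  have sm : shift_coef (pseries_diffs (pseries_diffs A)) m = m%:R * (m.+1%:R * A m.+1).
    by case: m => [|m] //=; rewrite mul0r.
  apply: (eq0 _ _ _ (recSS k E nu m.+1)).
  rewrite sm /A /rec_lead /rec_diag /rec_sub /pseries_diffs -/K.
  ring.
move=> e; rewrite -(cvg_unique (@norm_hausdorff _ _) e z); ring.
Qed.

End SolutionOfODE.

(** * Helicoidal tori *)

Section Helicoid.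
Variables (R : realType) (k : nat).

Lemma trig_periodic (f : R -> R) : periodic f (pi *+ 2) ->
  forall y (m : int), f (y + tau R * m%:~R) = f y.
Proof.
move=> fp y [n|n]; first by rewrite -pmulrn mulr_natr periodicn.
rewrite -[LHS](periodicn fp n.+1) NegzE mulrNz mulrN -pmulrn.
by rewrite mulr_natr subrK.
Qed.

Lemma cosDtau (y : R) (m : int) : cos (y + tau R * m%:~R) = cos y.
Proof. by apply: trig_periodic; exact: cosD2pi. Qed.

Lemma sinDtau (y : R) (m : int) : sin (y + tau R * m%:~R) = sin y.
Proof. by apply: trig_periodic; exact: sinD2pi. Qed.

Lemma periodic_teval H (e : term R) : lattice_periodic (teval k H e).
Proof.
move=> x m.
have e0 : tau R * (x + map_mx intr m) 0 0 = tau R * x 0 0 + tau R * (m 0 0)%:~R.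
  by rewrite !mxE mulrDr.
have e1 n : n%:R * (tau R * (x + map_mx intr m) 0 1) =
    n%:R * (tau R * x 0 1) + tau R * (n%:Z * m 0 1)%:~R.
  by rewrite !mxE mulrDr mulrDr intrM; congr (_ + _); rewrite mulrCA.
elim: e => [c|||n|n||j|a iha b ihb|a iha b ihb] //=.
- by rewrite e0 cosDtau.
- by rewrite e0 sinDtau.
- by rewrite e1 cosDtau.
- by rewrite e1 sinDtau.
- by rewrite /invW /W2 e0 cosDtau.
- by rewrite e0 sinDtau.
- by rewrite iha ihb.
- by rewrite iha ihb.
Qed.

Lemma periodic_tevalv H n (e : 'I_n -> term R) : lattice_periodic (tevalv k H e).
Proof. by move=> x m; apply/rowP => j; rewrite !mxE periodic_teval. Qed.

Definition row5 (a b c d e : R) : 'rV[R]_(3 + 2) := \row_j [:: a; b; c; d; e]`_j.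

Lemma dotv_lrow5 a b c d e a' b' c' d' e' :
  dotv (lsubmx (row5 a b c d e)) (lsubmx (row5 a' b' c' d' e')) =
  a * a' + b * b' + c * c'.
Proof. by rewrite /dotv !big_ord_recl big_ord0 !mxE /= addr0 ?addrA. Qed.

Lemma dotv_rrow5 a b c d e a' b' c' d' e' :
  dotv (rsubmx (row5 a b c d e)) (rsubmx (row5 a' b' c' d' e')) =
  d * d' + e * e'.
Proof. by rewrite /dotv !big_ord_recl big_ord0 !mxE /= addr0 ?addrA. Qed.

Lemma dotv_block (u v : 'rV[R]_(3 + 2)) :
  dotv u v = dotv (lsubmx u) (lsubmx v) + dotv (rsubmx u) (rsubmx v).
Proof.
by rewrite /dotv big_split_ord; congr (_ + _); apply: eq_bigr => i _; rewrite !mxE.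
Qed.

Lemma dotv_row5 a b c d e a' b' c' d' e' :
  dotv (row5 a b c d e) (row5 a' b' c' d' e') =
  a * a' + b * b' + c * c' + (d * d' + e * e').
Proof. by rewrite dotv_block dotv_lrow5 dotv_rrow5. Qed.

(** Symmetry moves the projection in [fund2] onto the normal, which it fixes. *)
Lemma dotv_tproj (p v w : 'rV[R]_(3 + 2)) :
  dotv (tproj p v) w = dotv v (tproj p w).
Proof.
rewrite !dotv_block {1 2}/tproj row_mxKl row_mxKr [RHS]addrC [RHS]addrC.
rewrite (dotvC _ (lsubmx w)) (dotvC _ (rsubmx w)) /tproj !row_mxKl !row_mxKr.
rewrite !dotvDr -!scaleNr !dotvZr (dotvC (lsubmx w)) (dotvC (rsubmx w)).
rewrite (dotvC (lsubmx w)) (dotvC (rsubmx w)).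

by ring.
Qed.

Definition term5 (a b c d e : term R) (j : 'I_(3 + 2)) : term R :=
  nth (Cst 0) [:: a; b; c; d; e] j.

Lemma tevalv_term5 H (f : term R -> term R) a b c d e x :
  tevalv k H (fun j => f (term5 a b c d e j)) x =
  row5 (teval k H (f a) x) (teval k H (f b) x) (teval k H (f c) x)
       (teval k H (f d) x) (teval k H (f e) x).
Proof. by apply/rowP => -[[|[|[|[|[|//]]]]] h]; rewrite !mxE. Qed.

Definition torus_term : 'I_(3 + 2) -> term R :=
  term5 (Mul (CosS R) (CosT R k)) (Mul (CosS R) (SinT R k)) (SinS R)
        (CosT R 1) (SinT R 1).

(** This is (e - k cos(s) T) / W, with e = (-sin kt, cos kt, 0) normal to the great circle in the
    sphere and T = (-sin t, cos t) tangent to the circle factor; the t-derivative of the torus is a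
    multiple of k cos(s) e + T. *)
Definition normal_term : 'I_(3 + 2) -> term R :=
  term5 (Mul (Cst (-1)) (Mul (InvW R) (SinT R k))) (Mul (InvW R) (CosT R k)) (Cst 0)
        (Mul (Cst k%:R) (Mul (InvW R) (Mul (CosS R) (SinT R 1))))
        (Mul (Cst (- k%:R)) (Mul (InvW R) (Mul (CosS R) (CosT R 1)))).

Let H0 : nat -> R -> R := fun _ _ => 0.

Let H0D j (y : R) : 0 <= y <= 1 -> is_derive y 1 (H0 j) (H0 j.+1 y).
Proof. by move=> _; exact: is_derive_cst. Qed.

Definition torus : 'rV[R]_2 -> 'rV[R]_(3 + 2) := tevalv k H0 torus_term.
Definition normal : 'rV[R]_2 -> 'rV[R]_(3 + 2) := tevalv k H0 normal_term.

Lemma pd_torus i x : pd i torus x = tevalv k H0 (fun j => dpar k i (torus_term j)) x.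
Proof. by rewrite /torus (pd_tevalv k H0D). Qed.

Lemma pd2_torus i j x : pd i (pd j torus) x =
  tevalv k H0 (fun l => dpar k i (dpar k j (torus_term l))) x.
Proof. by rewrite /torus (pd_tevalv k H0D) (pd_tevalv k H0D). Qed.

Lemma invW_sqr y : invW k y ^+ 2 * W2 k y = 1 :> R.
Proof.
have w0 := W2_gt0 k y.
by rewrite /invW exprVn sqr_sqrtr ?ltW // mulVf // gt_eqF.
Qed.

Lemma invW_gt0 (y : R) : 0 < invW k y.
Proof. by rewrite invr_gt0 sqrtr_gt0 W2_gt0. Qed.

Definition mx2 (a b c d : R) : 'M[R]_2 :=
  \matrix_(i, j) (if i == 0 then if j == 0 then a else b
                  else if j == 0 then c else d).

Lemma mulmx2 a b c d a' b' c' d' :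
  mx2 a b c d *m mx2 a' b' c' d' =
  mx2 (a * a' + b * c') (a * b' + b * d') (c * a' + d * c') (c * b' + d * d').
Proof.
by apply/matrixP => -[[|[|//]] hi] -[[|[|//]] hj];
  rewrite !mxE !big_ord_recl big_ord0 !mxE /= addr0.
Qed.

Lemma invmx_diag2 a d : a != 0 -> d != 0 -> invmx (mx2 a 0 0 d) = mx2 a^-1 0 0 d^-1.
Proof.
move=> a0 d0.
have e : mx2 a 0 0 d *m mx2 a^-1 0 0 d^-1 = 1%:M.
  rewrite mulmx2 !mulr0 !mul0r !addr0 !add0r !divff //.
  by apply/matrixP => -[[|[|//]] hi] -[[|[|//]] hj]; rewrite !mxE.
have [u _] := mulmx1_unit e.
by rewrite -[RHS](mulKmx u) e mulmx1.
Qed.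

Lemma mxtrace2 a b c d : \tr (mx2 a b c d) = a + d.
Proof. by rewrite /mxtrace !big_ord_recl big_ord0 !mxE /= addr0. Qed.

Lemma det_mx2 a b c d : \det (mx2 a b c d) = a * d - b * c.
Proof.
rewrite (expand_det_row _ 0) !big_ord_recl big_ord0 /cofactor !det_mx11 !mxE /=.
by rewrite /bump /= expr0 expr1; ring.
Qed.

Lemma tau_gt0 : 0 < tau R.
Proof. by rewrite /tau pmulrn_lgt0 // pi_gt0. Qed.

Lemma fund1_torus x :
  fund1 torus x = mx2 (tau R ^+ 2) 0 0 (tau R ^+ 2 * W2 k (tau R * x 0 0)).
Proof.
apply/matrixP => i j; rewrite mxE !pd_torus !tevalv_term5 dotv_row5 mxE /dpar.
have st := sin2cos2 (1%:R * (tau R * x 0 1)).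
have sk := sin2cos2 (k%:R * (tau R * x 0 1)).
have ss := sin2cos2 (tau R * x 0 0).
case: i => -[|[|//]] hi; case: j => -[|[|//]] hj; rewrite /= /W2.
- by ring: ss sk st.
- by ring: ss sk st.
- by ring: ss sk st.
- by ring: ss sk st.
Qed.

Lemma torus_S2xS1 x : S2xS1 (torus x).
Proof.
have st := sin2cos2 (1%:R * (tau R * x 0 1)).
have sk := sin2cos2 (k%:R * (tau R * x 0 1)).
have ss := sin2cos2 (tau R * x 0 0).
rewrite /torus (tevalv_term5 H0 id); split.
  rewrite /usphere /= dotv_lrow5 /=; ring: ss sk.
rewrite /usphere /= dotv_rrow5 /=; ring: st.
Qed.

Lemma normal_tproj x : tproj (torus x) (normal x) = normal x.
Proof.
apply/rowP => j; rewrite tprojE.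
have -> : bdot j (normal x) (torus x) = 0; last by rewrite mul0r subr0.
rewrite /bdot /normal /torus !(tevalv_term5 H0 id) dotv_lrow5 dotv_rrow5 /=.
by case: ifP => _; ring.
Qed.

Lemma normal_norm x : dotv (normal x) (normal x) = 1.
Proof.
have st := sin2cos2 (1%:R * (tau R * x 0 1)).
have sk := sin2cos2 (k%:R * (tau R * x 0 1)).
rewrite /normal (tevalv_term5 H0 id) dotv_row5 /= -[RHS](invW_sqr (tau R * x 0 0)) /W2.
by ring: st sk.
Qed.

Lemma pd_torus_normal i x : dotv (pd i torus x) (normal x) = 0.
Proof.
have st := sin2cos2 (1%:R * (tau R * x 0 1)).
have sk := sin2cos2 (k%:R * (tau R * x 0 1)).
rewrite pd_torus tevalv_term5 /normal (tevalv_term5 H0 id) dotv_row5 /dpar.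
case: i => -[|[|//]] hi; rewrite /=.
by ring: st sk.
by ring: st sk.
Qed.

(** The diagonal vanishes because the s-curves are great circles and the t-curves have acceleration
    orthogonal to the normal; as the metric is diagonal, minimality follows. *)
Lemma fund2_torus x : fund2 torus normal x =
  mx2 0 (- (tau R ^+ 2 * k%:R * sin (tau R * x 0 0) * invW k (tau R * x 0 0)))
      (- (tau R ^+ 2 * k%:R * sin (tau R * x 0 0) * invW k (tau R * x 0 0))) 0.
Proof.
have st := sin2cos2 (1%:R * (tau R * x 0 1)).
have sk := sin2cos2 (k%:R * (tau R * x 0 1)).
apply/matrixP => i j; rewrite mxE dotv_tproj normal_tproj.
rewrite pd2_torus (tevalv_term5 H0 (fun e => dpar k i (dpar k j e))) /normal.
rewrite (tevalv_term5 H0 id) dotv_row5 mxE /dpar.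
case: i => -[|[|//]] hi; case: j => -[|[|//]] hj; rewrite /=.
- by ring: sk st.
- by ring: sk st.
- by ring: sk st.
- by ring: sk st.
Qed.

Lemma shape_op_torus x : shape_op torus normal x =
  mx2 0 (- (k%:R * sin (tau R * x 0 0) * invW k (tau R * x 0 0)))
      (- (k%:R * sin (tau R * x 0 0) * invW k (tau R * x 0 0) ^+ 3)) 0.
Proof.
have t0 : tau R != 0 by rewrite gt_eqF // tau_gt0.
have w0 : W2 k (tau R * x 0 0) != 0 by rewrite gt_eqF // W2_gt0.
have w1 := invW_sqr (tau R * x 0 0).
have F1 (t a s v : R) : t != 0 -> t ^- 2 * - (t ^+ 2 * a * s * v) = - (a * s * v).
  by move=> tn0; field.
have F2 (t a s v w : R) : t != 0 -> w != 0 -> v ^+ 2 * w = 1 ->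
    (t ^+ 2 * w)^-1 * - (t ^+ 2 * a * s * v) = - (a * s * v ^+ 3).
  move=> tn0 wn0 e; have -> : v ^+ 3 = v / w.
    by apply: (mulIf wn0); rewrite divfK // -[RHS]mulr1 -e; ring.
  by field; rewrite tn0 wn0.
rewrite /shape_op fund1_torus fund2_torus invmx_diag2 ?mulf_neq0 ?expf_neq0 //.
by rewrite mulmx2 !mulr0 !mul0r !addr0 !add0r F1 // F2.
Qed.

Lemma minimal_torus : minimal torus normal.
Proof. by move=> x; rewrite shape_op_torus mxtrace2 addr0. Qed.

Lemma fund2_norm2_torus x : fund2_norm2 torus normal x =
  2 * k%:R ^+ 2 * sin (tau R * x 0 0) ^+ 2 * invW k (tau R * x 0 0) ^+ 4.
Proof. by rewrite /fund2_norm2 shape_op_torus mulmx2 mxtrace2; ring. Qed.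

Lemma ricci_torus x : ricci (torus x) (normal x) (normal x) = invW k (tau R * x 0 0) ^+ 2.
Proof.
have sk := sin2cos2 (k%:R * (tau R * x 0 1)).
rewrite ricci_tangent; [|exact: torus_S2xS1|exact: normal_tproj].
rewrite /normal (tevalv_term5 H0 id) dotv_lrow5 /=.
by ring: sk.
Qed.

Lemma unit_normal_torus : unit_normal torus normal.
Proof.
split.
- exact: (smooth_tevalv k H0D).
- exact: periodic_tevalv.
- exact: normal_tproj.
- by move=> x i; exact: pd_torus_normal.
- exact: normal_norm.
Qed.

(** Let d in [0, tau) be [b - a] modulo [tau]. Then 1 = cos d = 1 - 2 sin(d/2)^2, and sin > 0 on (0,
    pi) leaves d = 0. *)
Lemma cos_sin_eq (a b : R) : cos a = cos b -> sin a = sin b ->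
  exists m : int, b = a + tau R * m%:~R.
Proof.
move=> ec es; pose m := Num.floor ((b - a) / tau R).
have t0 := tau_gt0.
exists m; pose d := b - a - tau R * m%:~R.
have d0 : 0 <= d by rewrite /d subr_ge0 -ler_pdivlMl // mulrC ge_floor.
have dt : d < tau R.
  have : (b - a) / tau R < m%:~R + 1 by rewrite -[1]/(1%:~R) -intrD floorD1_gt.
  by rewrite ltr_pdivrMr // /d; lra.
have cd : cos d = 1.
  rewrite /d -mulrN -mulrNz cosDtau cosB ec es -[RHS](cos2Dsin2 b); ring.
suff : d = 0 by rewrite /d => h; lra.
apply/eqP; rewrite eq_le d0 andbT leNgt.
apply/negP => dp.
have : 0 < sin (d / 2).
  apply: sin_gt0_pi; rewrite divr_gt0 //= ltr_pdivrMr // mulr_natr.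
  exact: dt.
have : cos (d / 2 *+ 2) = 1 by rewrite -mulr_natr divfK.
rewrite cos_mulr2n cos2sin2 => h sp.
have : 0 < sin (d / 2) ^+ 2 by rewrite exprn_gt0.
by move: h; rewrite mulr2n; lra.
Qed.

(** The circle factor determines t modulo [tau], hence also the angle kt since k is an integer; the
    sphere factor then determines s. *)
Lemma torus_injective x y : torus x = torus y ->
  exists m : 'rV[int]_2, y = x + map_mx intr m.
Proof.
move=> e.
have t0 : tau R != 0 by rewrite gt_eqF // tau_gt0.
have comp j : torus x 0 j = torus y 0 j by rewrite e.
have := comp (rshift 3 0); have := comp (rshift 3 1).
rewrite /torus !mxE /= !mul1r => es ec.
have [m1 h1] := cos_sin_eq ec es.
have hk : k%:R * (tau R * y 0 1) = k%:R * (tau R * x 0 1) + tau R * (k%:Z * m1)%:~R.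
  by rewrite h1 mulrDr intrM -pmulrn; congr (_ + _); rewrite mulrCA.
have := comp (lshift 2 (Ordinal (isT : (0 < 3)%N))).
have := comp (lshift 2 (Ordinal (isT : (1 < 3)%N))).
have := comp (lshift 2 (Ordinal (isT : (2 < 3)%N))).
rewrite /torus !mxE /term5 /= hk cosDtau sinDtau => es0 e1 e0.
(* Both points share the vector (cos kt, sin kt); being of length 1, it can be cancelled even where
   one of its entries is 0. *)
have cancel_unit (u v c d : R) : c ^+ 2 + d ^+ 2 = 1 ->
    u * c = v * c -> u * d = v * d -> u = v.
  by move=> h hc hd; rewrite -[u]mulr1 -[v]mulr1 -h !mulrDr !expr2 !mulrA hc hd.
have ec0 := cancel_unit _ _ _ _ (cos2Dsin2 _) e0 e1.
have [m0 h0] := cos_sin_eq ec0 es0.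
exists (\row_j if j == 0 then m0 else m1); apply/rowP => j; rewrite !mxE.
apply: (mulfI t0); rewrite mulrDr.
case: j => -[|[|//]] hj /=.
  by rewrite (_ : Ordinal hj = 0) //; exact: val_inj.
by rewrite (_ : Ordinal hj = 1) //; exact: val_inj.
Qed.

Lemma embedded_torus_torus : embedded_torus torus.
Proof.
split.
- exact: (smooth_tevalv k H0D).
- exact: periodic_tevalv.
- exact: torus_S2xS1.
- exact: torus_injective.
- move=> x; set M := \matrix_i _.
  (* The first fundamental form is the Gram matrix of the rows of [M], so its inverse yields a right
     inverse of [M]. *)
  have e : M *m M^T = fund1 torus x.
    apply/matrixP => i j; rewrite !mxE; apply: eq_bigr => l _.
    by rewrite !mxE.
  have u : fund1 torus x \in unitmx.
    rewrite fund1_torus unitmxE unitfE det_mx2.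
    by rewrite mulr0 subr0 !mulf_neq0 ?expf_neq0 ?gt_eqF ?tau_gt0 ?W2_gt0.
  apply/row_freeP; exists (M^T *m invmx (fund1 torus x)).
  by rewrite mulmxA e mulmxV.
Qed.

End Helicoid.

(** * Eigenfunctions and Morse index *)

Section StabilityOperator.
Variables (R : realType) (k : nat) (H : nat -> R -> R).
Hypothesis HD : forall j (y : R), 0 <= y <= 1 -> is_derive y 1 (H j) (H j.+1 y).

Let W2_term : term R := Add (Cst 1) (Mul (Cst (k%:R ^+ 2)) (Mul (CosS R) (CosS R))).

Lemma sqrt_det_torus x : Num.sqrt (\det (fund1 (@torus R k) x)) =
  tau R ^+ 2 * (W2 k (tau R * x 0 0) * invW k (tau R * x 0 0)).
Proof.
have w0 := W2_gt0 k (tau R * x 0 0).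
have t0 := @tau_gt0 R.
rewrite fund1_torus det_mx2 mulr0 subr0.
have -> : tau R ^+ 2 * (tau R ^+ 2 * W2 k (tau R * x 0 0)) =
    (tau R ^+ 2) ^+ 2 * W2 k (tau R * x 0 0) by rewrite mulrA -expr2.
rewrite sqrtrM ?sqr_ge0 // sqrtr_sqr ger0_norm ?sqr_ge0 //.
congr (_ * _); rewrite /invW -[X in _ = X / _](sqr_sqrtr (ltW w0)) expr2 mulfK //.
by rewrite gt_eqF // sqrtr_gt0.
Qed.

(** In s and t the metric is ds^2 + W^2 dt^2, with fluxes W u_s and u_t / W. Writing W as W^2 times
    1/W keeps both within the syntax of terms, so the outer derivatives are again symbolic. *)
Lemma laplacian_torus u x : laplacian (@torus R k) (teval k H u) x =
  tau R ^- 2 * invW k (tau R * x 0 0) *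
   (teval k H (ds k (Mul (Mul W2_term (InvW R)) (ds k u))) x
    + teval k H (dt (Mul (InvW R) (dt u))) x).
Proof.
have t0 : tau R != 0 by rewrite gt_eqF // tau_gt0.
have w0 y : W2 k (tau R * y) != 0 :> R by rewrite gt_eqF // W2_gt0.
have v0 y : invW k (tau R * y) != 0 :> R by rewrite gt_eqF // invW_gt0.
have ginv y : invmx (fund1 (@torus R k) y) =
    mx2 (tau R ^- 2) 0 0 (tau R ^+ 2 * W2 k (tau R * y 0 0))^-1.
  by rewrite fund1_torus invmx_diag2 // ?mulf_neq0 ?expf_neq0.
have F0 (t w v a b : R) : t != 0 -> w != 0 ->
    t ^+ 2 * (w * v) * (t ^- 2 * a + 0 * b) = w * v * a.
  by move=> *; field.
have F1 (t w v a b : R) : t != 0 -> w != 0 ->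
  t ^+ 2 * (w * v) * (0 * a + (t ^+ 2 * w)^-1 * b) = v * b.
  by move=> t1 w1; field; rewrite t1 w1.
have F2 (t w v : R) : t != 0 -> w != 0 -> v != 0 -> v ^+ 2 * w = 1 ->
   (t ^+ 2 * (w * v))^-1 = t ^- 2 * v.
  move=> t1 w1 v1 e; have -> : w = v ^- 2.
    by apply: (mulfI (expf_neq0 2 v1)); rewrite e divff // expf_neq0.
  by field; rewrite t1 v1.
rewrite /laplacian sqrt_det_torus F2 ?invW_sqr // !big_ord_recl big_ord0 addr0.
congr (_ * (_ + _)).
  rewrite -[ds k _]/(dpar k 0 _) -(pd_teval k HD); congr (pd _ _ x).
  apply/funext => y; rewrite sqrt_det_torus ginv !big_ord_recl big_ord0 addr0 !mxE /=.
  rewrite !(pd_teval k HD) /dpar /= F0 //.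
rewrite -[dt _]/(dpar k (lift ord0 ord0) _) -(pd_teval k HD); congr (pd _ _ x).
apply/funext => y; rewrite sqrt_det_torus ginv !big_ord_recl big_ord0 addr0 !mxE /=.
by rewrite !(pd_teval k HD) /dpar /= F1.
Qed.

Definition mode_term (m : nat) : term R :=
  Mul (Mul (Ser R 0) (InvW R)) (CosT R m).

(** At y = sin(s)^2 one has 1 + k^2 - k^2 y = W^2 and 1 - y = cos(s)^2; then L phi - nu phi is cos(m
    t) / W^3 times the left side of the equation. *)
Lemma mode_eigenfunction m nu :
  (forall y : R, 0 <= y <= 1 ->
    (1 + k%:R ^+ 2 - k%:R ^+ 2 * y) * (1 - y) * (H 1 y *+ 2 + 4 * y * H 2 y)
    - (y *+ 2) * H 1 y
    + (1 + k%:R ^+ 2 - m%:R ^+ 2 - nu * (1 + k%:R ^+ 2 - k%:R ^+ 2 * y)) * H 0 y = 0) ->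
  eigenfunction (@torus R k) (@normal R k) (- nu) (teval k H (mode_term m)).
Proof.
move=> ode; split; [exact: (smooth_teval k HD)|exact: periodic_teval|move=> x].
rewrite /stability_op laplacian_torus fund2_norm2_torus ricci_torus.
have t0 : tau R != 0 by rewrite gt_eqF // tau_gt0.
have y01 : 0 <= sin (tau R * x 0 0) ^+ 2 <= 1.
  by rewrite sqr_ge0 /= sin2cos2 gerBl sqr_ge0.
have := ode _ y01; have := @invW_sqr R k (tau R * x 0 0); rewrite /W2.
have := sin2cos2 (tau R * x 0 0).
rewrite /mode_term /=.
set s := sin (tau R * x 0 0); set c := cos (tau R * x 0 0).
set v := invW k _; set h0 := H 0 _; set h1 := H 1 _; set h2 := H 2 _.
set cm := cos _; set sm := sin _.
clearbody h0 h1 h2 v cm sm; clearbody s c.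
move: (tau R) t0 (k%:R : R) (m%:R : R) => t t0 K M es ev o.
have ev' : K ^+ 2 * c ^+ 2 * v ^+ 2 = 1 - v ^+ 2 by rewrite -ev; ring.
have clear_den (a b d : R) : t ^+ 2 * (t ^- 2 * v * a + b + d) = v * a + t ^+ 2 * (b + d).
  by field.
have o' := congr1 (fun z => t ^+ 2 * v ^+ 3 * cm * z) o.
apply: (mulfI (expf_neq0 2 t0)); rewrite clear_den.
apply: (etrans _ (etrans o' _)); last by rewrite !mulr0.
by rewrite /=; ring: es ev'.
Qed.

End StabilityOperator.

(** * Independence of the modes and the lower bound on the index *)

Section MorseIndex.
Variable R : realType.

(** The bound m <= k enters through E = 1 + k^2 - m^2 > 0, from which [rec_decay] produces a
    positive [nu]. *)
Lemma ode_solution (k m : nat) : (0 < k)%N -> (m <= k)%N ->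
  exists2 nu : R, 0 < nu & exists H : nat -> R -> R, [/\ H 0 0 = 1,
    forall j (y : R), 0 <= y <= 1 -> is_derive y 1 (H j) (H j.+1 y) &
    forall y : R, 0 <= y <= 1 ->
    (1 + k%:R ^+ 2 - k%:R ^+ 2 * y) * (1 - y) * (H 1 y *+ 2 + 4 * y * H 2 y)
    - (y *+ 2) * H 1 y
    + (1 + k%:R ^+ 2 - m%:R ^+ 2 - nu * (1 + k%:R ^+ 2 - k%:R ^+ 2 * y)) * H 0 y = 0].
Proof.
move=> k0 mk.
have k0' : 0 < k%:R :> R by rewrite ltr0n.
have E0 : 0 < 1 + k%:R ^+ 2 - m%:R ^+ 2 :> R.
  have : m%:R ^+ 2 <= k%:R ^+ 2 :> R by rewrite lerXn2r ?nnegrE ?ler0n // ler_nat.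
  lra.
have [nu nu0 [A0 Adec]] := rec_decay k0' E0.
exists nu => //; exists (pser (rec k%:R (1 + k%:R ^+ 2 - m%:R ^+ 2) nu)); split.
- by rewrite pser0.
- by move=> j y; exact: is_derive_pser.
- by move=> y y01; exact: (pser_rec_ode Adec y01).
Qed.

(* f(t + h) + f(t - h) acts on cos(m t) as multiplication by 2 cos(m h); these
   eigenvalues are distinct for h = pi / n and m < n. *)
Lemma cos_lin_indep n : lin_indep (fun (i : 'I_n) (t : R) => cos (i%:R * t)).
Proof.
move=> c hc m.
have n0 : (0 < n)%N by apply: leq_ltn_trans (ltn_ord m).
pose h : R := pi / n%:R; pose l (i : 'I_n) : R := cos (i%:R * h) *+ 2.
have n0' : 0 < n%:R :> R by rewrite ltr0n.
have l_inj : injective l.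
  move=> i j; rewrite /l => /(pmulrnI (isT : (0 < 2)%N)).
  have b (q : 'I_n) : q%:R * h \in `[0, pi].
    rewrite in_itv /= mulr_ge0 ?divr_ge0 ?pi_ge0 ?ler0n //=.
    rewrite mulrC -mulrA ler_piMr ?pi_ge0 // mulrC ler_pdivrMr // mul1r ler_nat.
    exact: ltnW.
  move/(cos_inj (b i) (b j))/(mulIf _) => e; apply/val_inj/eqP.
  rewrite -(eqr_nat R); apply/eqP/e.
  by rewrite mulf_neq0 ?invr_eq0 ?gt_eqF ?pi_gt0.
(* Applying a polynomial p in that operator to the relation multiplies its i-th term by p(l_i). *)
have poly_l (p : {poly R}) t : \sum_(i < n) c i * (p.[l i] * cos (i%:R * t)) = 0.
  elim/poly_ind: p t => [|p a ih] t.
    by rewrite big1 // => i _; rewrite horner0 mul0r mulr0.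
  transitivity ((\sum_(i < n) c i * (p.[l i] * cos (i%:R * (t + h)))
     + \sum_(i < n) c i * (p.[l i] * cos (i%:R * (t - h))))
     + a * \sum_(i < n) c i * cos (i%:R * t)).
    rewrite mulr_sumr -!big_split /=; apply: eq_bigr => i _.
    rewrite hornerD hornerMX hornerC [i%:R * (t + h)]mulrDr.
    by rewrite [i%:R * (t - h)]mulrBr cosD cosB /l; ring.
  by rewrite !ih hc mulr0 !addr0.
(* This polynomial kills every eigenvalue except the m-th, so at t = 0 a single term remains. *)
pose q : {poly R} := \prod_(j < n | j != m) ('X - (l j)%:P).
have ql i : q.[l i] = \prod_(j < n | j != m) (l i - l j).
  by rewrite /q horner_prod; apply: eq_bigr => j _; rewrite hornerXsubC.
have := poly_l q 0.
rewrite (bigD1 m) //= big1 ?addr0 => [|i im].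
  rewrite mulr0 cos0 mulr1 ql => /eqP; rewrite mulf_eq0 => /orP[/eqP//|].
  move=> /eqP q0; have : \prod_(j < n | j != m) (l m - l j) != 0; last by rewrite q0 eqxx.
  by apply/prodf_neq0 => j jm; rewrite subr_eq0 (inj_eq l_inj) eq_sym.
by rewrite ql (bigD1 i) //= subrr !mul0r mulr0.
Qed.

Lemma lin_indep_comp (T : Type) n p (phi : 'I_n -> T -> R) (g : 'I_p -> 'I_n) :
  injective g -> lin_indep phi -> lin_indep (fun j => phi (g j)).
Proof.
move=> g_inj ind c hc j.
have := ind (fun i => \sum_(j | g j == i) c j) _ (g j).
rewrite (eq_bigl (pred1 j)) => [|i]; last by rewrite /= (inj_eq g_inj).
rewrite big_pred1_eq; apply => x; rewrite -[RHS](hc x).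
rewrite (partition_big g predT) //=; apply: eq_bigr => i _.
by rewrite mulr_suml; apply: eq_bigr => j' /eqP ->.
Qed.

Lemma multiplicity_ge F N mu n (phi : 'I_n -> 'rV[R]_2 -> R) :
  (forall i, eigenfunction F N mu (phi i)) -> lin_indep phi ->
  ((n%:R)%:E <= multiplicity F N mu)%E.
Proof.
by move=> e ind; apply: ereal_sup_ubound; exists n => //; exists phi.
Qed.

(** The values [mu i] may repeat, so the family is grouped by eigenvalue: the size of each group is
    at most the multiplicity, and the sizes add up to n. *)
Lemma morse_index_ge F N n (mu : 'I_n -> R) (phi : 'I_n -> 'rV[R]_2 -> R) :
  (forall i, mu i < 0) -> (forall i, eigenfunction F N (mu i) (phi i)) ->
  lin_indep phi -> ((n%:R)%:E <= morse_index F N)%E.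
Proof.
move=> mu0 e ind; pose s := undup (codom mu).
have us : uniq s by exact: undup_uniq.
pose nb v := #|[pred i | mu i == v]|.
have mult v : ((nb v)%:R%:E <= multiplicity F N v)%E.
  apply: (@multiplicity_ge _ _ _ _ (fun j => phi (enum_val j))).
    move=> j; have /eqP mj : mu (enum_val j) == v by have := enum_valP j; rewrite inE.
    by have := e (enum_val j); rewrite mj.
  exact: (@lin_indep_comp _ _ _ phi _ (@enum_val_inj _ _) ind).
apply: esum_ge; exists [set` s].
  split; first exact: finite_seq.
  by move=> v /=; rewrite mem_undup => /codomP[i ->].
rewrite -fsbig_seq //.

apply: (@le_trans _ _ (\sum_(v <- s) (nb v)%:R%:E)%E).
  rewrite sumEFin -natr_sum lee_fin ler_nat /nb.
  under eq_bigr do rewrite -sum1_card big_mkcond /=.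
  rewrite exchange_big /= -[leqLHS]card_ord -sum1_card; apply: leq_sum => i _.
  rewrite (bigD1_seq (mu i)) //=; last by rewrite mem_undup codom_f.
  by rewrite ?inE eqxx.
by apply: lee_sum => v _; exact: mult.
Qed.

Lemma morse_index_torus k : (0 < k)%N ->
  ((k.+1%:R)%:E <= morse_index (@torus R k) (@normal R k))%E.
Proof.
move=> k0.
have /choice[w hw] : forall m : 'I_k.+1, exists w : R * (nat -> R -> R), [/\ 0 < w.1,
    w.2 0%N 0 = 1, (forall j (y : R), 0 <= y <= 1 -> is_derive y 1 (w.2 j) (w.2 j.+1 y))
    & eigenfunction (@torus R k) (@normal R k) (- w.1) (teval k w.2 (mode_term R m))].
  move=> m; have [nu nu0 [H [h0 HD ode]]] := ode_solution k0 (ltn_ord m : (m <= k)%N).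
  by exists (nu, H); split=> //; exact: mode_eigenfunction.
apply: (@morse_index_ge _ _ _ (fun m => - (w m).1)
   (fun m => teval k (w m).2 (mode_term R m))).
- by move=> m; rewrite oppr_lt0; case: (hw m).
- by move=> m; case: (hw m).
move=> c hc; apply: cos_lin_indep => t.
(* On the circle s = 0 each mode reduces to [invW k 0] times cos(m t), since its series equals 1 at
   0; this leaves a relation between cosines. *)
have := hc (\row_j if j == 1 then t / tau R else 0).
rewrite (eq_bigr (fun m : 'I_k.+1 => invW k 0 * (c m * cos (m%:R * t)))) => [|m _].
  by rewrite -mulr_sumr => /eqP; rewrite mulf_eq0 gt_eqF ?invW_gt0 //= => /eqP.
rewrite /= !mxE /= mulr0 sin0 expr0n /=; case: (hw m) => _ -> _ _.
have t0 : tau R != 0 by rewrite gt_eqF // tau_gt0.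
by rewrite mul1r [tau R * _]mulrC divfK // mulrCA.
Qed.

End MorseIndex.

(** * Hausdorff convergence *)

Section Hausdorff.
Variable R : realType.

Lemma polar2 (a b : R) : a ^+ 2 + b ^+ 2 = 1 ->
  exists u : R, a = cos u /\ b = sin u.
Proof.
move=> ab.
have a1 : -1 <= a <= 1.
  have := sqr_ge0 b; have : a ^+ 2 = 1 - b ^+ 2 by rewrite -ab; ring.
  by move=> h1 h2; rewrite -ler_norml -(@expr_le1 _ 2) // real_normK ?num_real //; lra.
have b2 : 1 - a ^+ 2 = b ^+ 2 by rewrite -ab; ring.
have ca : cos (acos a) = a by rewrite acosK // in_itv.
have [b0|b0] := leP 0 b.
  by exists (acos a); rewrite ca sin_acos // b2 sqrtr_sqr ger0_norm.
exists (- acos a); rewrite cosN sinN ca sin_acos // b2 sqrtr_sqr ltr0_norm //.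
by rewrite opprK.
Qed.

Lemma polar3 (a b c : R) : a ^+ 2 + b ^+ 2 + c ^+ 2 = 1 ->
  exists s u : R, [/\ a = cos s * cos u, b = cos s * sin u & c = sin s].
Proof.
move=> abc; pose r := Num.sqrt (a ^+ 2 + b ^+ 2).
have r2 : r ^+ 2 = a ^+ 2 + b ^+ 2 by rewrite sqr_sqrtr // addr_ge0 // sqr_ge0.
have [s [rs cs]] : exists s, r = cos s /\ c = sin s by apply: polar2; rewrite r2.
(* At the poles the longitude is arbitrary. *)
have [r0|r0] := eqVneq r 0.
  exists s, 0; rewrite -rs r0 !mul0r -cs.
  move: r2; rewrite r0 expr0n /= => /esym/eqP.
  by rewrite paddr_eq0 ?sqr_ge0 // !sqrf_eq0 => /andP[/eqP -> /eqP ->].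
have [u [au bu]] : exists u, a / r = cos u /\ b / r = sin u.
  by apply: polar2; rewrite !expr_div_n -mulrDl -r2 divff // expf_neq0.
by exists s, u; rewrite -rs -au -bu; split=> //; rewrite mulrC divfK.
Qed.

(** The squared chord is 2 - 2 cos(u - v), and cos is continuous at 0. *)
Lemma chord_small (e : R) : 0 < e -> exists2 d : R, 0 < d &
  forall u v : R, `|u - v| < d -> (cos u - cos v) ^+ 2 + (sin u - sin v) ^+ 2 < e.
Proof.
move=> e0.
have c0 : 1 - e / 2 < cos (0 : R) by rewrite cos0; lra.
have : \forall x \near (0 : R), 1 - e / 2 < cos x.
  exact: (@continuous_cos R 0) (lt_nbhsr c0).
move=> /nbhs_ballP[d /= d0 hd]; exists d => // u v uv.
have : 1 - e / 2 < cos (u - v).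
  by apply: hd; rewrite -ball_normE /= sub0r normrN.
have := cos2Dsin2 u; have := cos2Dsin2 v; rewrite cosB; lra.
Qed.

Lemma edistE (u v : 'rV[R]_(3 + 2)) : Defs.edist u v =
  Num.sqrt (dotv (lsubmx u - lsubmx v) (lsubmx u - lsubmx v)
          + dotv (rsubmx u - rsubmx v) (rsubmx u - rsubmx v)).
Proof. by rewrite /Defs.edist dotv_block !linearB. Qed.

Lemma usphere2 (y : 'rV[R]_2) : usphere y -> y 0 0 ^+ 2 + y 0 1 ^+ 2 = 1.
Proof.
rewrite /usphere /dotv /= => <-; rewrite !big_ord_recl big_ord0 addr0 !expr2.
by rewrite (_ : lift ord0 ord0 = 1) //; exact: val_inj.
Qed.

(** Let b have longitude u, latitude s and circle angle w. Some t within [tau] / k of w satisfies kt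
    = u modulo [tau]; the torus point at (s, t) has the same sphere component as b, and its circle
    component is close. *)
Lemma torus_dense (e : R) : 0 < e -> \forall k \near \oo,
  forall b, S2xS1 b -> exists2 a, range (@torus R k) a & Defs.edist a b < e.
Proof.
move=> e0.
have [d d0 hd] := chord_small (exprn_gt0 2 e0).
have t0 := @tau_gt0 R.
near=> k => b [b1 b2].
have k0 : 0 < k%:R :> R by near: k; exact: nbhs_infty_gtr.
have kd : tau R / d < k%:R by near: k; exact: nbhs_infty_gtr.
have [s [u [bs bc bu]]] : exists s u : R, [/\ lsubmx b 0 0 = cos s * cos u,
    lsubmx b 0 1 = cos s * sin u & lsubmx b 0 (lift ord0 (lift ord0 ord0)) = sin s].
  apply: polar3; rewrite -[RHS]b1 /dotv !big_ord_recl big_ord0 addr0 !expr2 addrA.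
  by congr (_ * _ + _ * _ + _ * _); congr (lsubmx b _ _); exact: val_inj.
have [w [wc ws]] := polar2 (usphere2 b2).
pose j := Num.floor ((k%:R * w - u) / tau R).
pose t := (u + tau R * j%:~R) / k%:R.
have kt : k%:R * t = u + tau R * j%:~R by rewrite /t mulrC divfK // gt_eqF.
have tw : `|t - w| < d.
  have j1 : tau R * j%:~R <= k%:R * w - u by rewrite -ler_pdivlMl // mulrC ge_floor.
  have j2 : k%:R * w - u < tau R * j%:~R + tau R.
    have : (k%:R * w - u) / tau R < j%:~R + 1 by rewrite -[1]/(1%:~R) -intrD floorD1_gt.
    by rewrite ltr_pdivrMr //; lra.
  have h : k%:R * `|t - w| < k%:R * d.
    rewrite -{1}(gtr0_norm k0) -normrM mulrBr kt ler0_norm; last by lra.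
    by move: kd; rewrite ltr_pdivrMr //; lra.
  by rewrite ltr_pM2l in h.
pose x : 'rV[R]_2 := \row_i if i == 0 then s / tau R else t / tau R.
exists (torus k x); first by exists x.
have x0 : tau R * x 0 0 = s by rewrite mxE /= mulrC divfK // gt_eqF.
have x1 : tau R * x 0 1 = t by rewrite mxE /= mulrC divfK // gt_eqF.
have -> : torus k x = row_mx (lsubmx b) (\row_i if i == 0 then cos t else sin t).
  rewrite /torus (tevalv_term5 k (fun _ _ => 0) id) /= x0 x1 mul1r kt cosDtau sinDtau.
  rewrite -bs -bc -bu; apply/rowP => i; rewrite mxE.
  case: (splitP i) => l il.
    have -> : i = lshift 2 l by exact: val_inj.
    rewrite row_mxEl; case: l {il} => -[|[|[|//]]] hl /=;
      by congr (lsubmx b _ _); exact: val_inj.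
  have -> : i = rshift 3 l by exact: val_inj.
  by rewrite row_mxEr !mxE; case: l {il} => -[|[|//]] hl.
rewrite edistE row_mxKl row_mxKr subrr.
have -> : dotv (0 : 'rV[R]_3) 0 = 0 by rewrite /dotv big1 // => i _; rewrite mxE mul0r.
rewrite add0r -[ltRHS](gtr0_norm e0) -sqrtr_sqr ltr_sqrt ?exprn_gt0 //.
rewrite /dotv !big_ord_recl big_ord0 addr0 !mxE /= -!expr2.
have l1 : rsubmx b 0 (lift ord0 ord0) = sin w.
  by rewrite -ws; congr (rsubmx b _ _); exact: val_inj.
move: l1 wc; rewrite !mxE => -> ->; exact: hd.
Unshelve. all: by end_near. Qed.

(** The spheres fill the product, so one half holds with distance 0 and the other is density. *)
Lemma hausdorff_torus : hausdorff_cvg (fun k => range (@torus R k.+1))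
  (\bigcup_(t in usphere (R := R) (n := 2)) parallel_sphere t).
Proof.
move=> e e0.
have [K _ hK] := torus_dense e0.
exists K => // k /= Kk; split.
  move=> _ [x _ <-]; have [x1 x2] := torus_S2xS1 k.+1 x.
  exists (torus k.+1 x); first by exists (rsubmx (torus k.+1 x)).
  rewrite /Defs.edist subrr /dotv big1 ?sqrtr0 // => i _; by rewrite mxE mul0r.
move=> b [t t1 [b1 b2]]; apply: (hK k.+1); first exact: leqW.
by split=> //; rewrite b2.
Qed.

End Hausdorff.

Theorem theorem1p5 (R : realType) :
  exists F N : nat -> 'rV[R]_2 -> 'rV[R]_(3 + 2),
    [/\ forall k, embedded_torus (F k),
        forall k, unit_normal (F k) (N k),
        forall k, minimal (F k) (N k),
        morse_index (F k) (N k) @[k --> \oo] --> +oo%E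
      & hausdorff_cvg (fun k => range (F k))
          (\bigcup_(t in usphere (R := R) (n := 2)) parallel_sphere t)].
Proof.
(* The shift keeps the winding number positive, as the index bound requires. *)
exists (fun k => @torus R k.+1), (fun k => @normal R k.+1); split.
- by move=> k; exact: embedded_torus_torus.
- by move=> k; exact: unit_normal_torus.
- by move=> k; exact: minimal_torus.
- apply/cvgeyPge => A; near=> k.
  apply: le_trans (morse_index_torus R (ltn0Sn k)).
  rewrite lee_fin (@le_trans _ _ k%:R) ?ler_nat //; last by rewrite !leqW.
  by apply/ltW; near: k; exact: nbhs_infty_gtr.
- exact: hausdorff_torus.
Unshelve. all: by end_near. Qed.
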